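(* Let $0<\alpha<1/3$. There exists $\gamma_*\in(1,\infty)$ such that for every $d>0$ the following hold. (1) If $1<\gamma\le\gamma_*$, the system $\dot\theta=G_1(\theta,W)$, $\dot W=G_2(\theta,W)$ has no equilibria in $\Omega_\gamma$, and for every $(\theta_0,W_0)\in\Omega_\gamma$ the following are equivalent: (i) the solution starting from $(\theta_0,W_0)$ is a leapfrogging solution; (ii) $\mathcal G(\theta_0,W_0)>\dfrac{\pi\gamma^{3/2}}{2d^{1/2}}$. (2) If $\gamma>\gamma_*$, the system has exactly one equilibrium $(\theta_*,0)$ in $\Omega_\gamma$, with $\theta_*\in(\theta_\gamma,\infty)$; there is a unique $\overline\theta\in(0,\theta_\gamma)$ with $\mathcal G(\overline\theta,0)=\mathcal G(\theta_*,0)$; and for every $(\theta_0,W_0)\in\Omega_\gamma$ the following are equivalent: (iii) the solution starting from $(\theta_0,W_0)$ is a leapfrogging solution; (iv) $\theta_0\in(\overline\theta,\theta_* )$ and $\mathcal G(\theta_0,W_0)>\mathcal G(\theta_*,0)$.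
   Context: For $\gamma>1$, $d>0$, $\alpha>0$: let $\theta_\gamma=\operatorname{artanh}(\gamma^{-1/2})$ (the unique $\theta>0$ with $\cosh\theta=\gamma^{1/2}\sinh\theta$) and $\Omega_\gamma=\{(\theta,W)\in\mathbb{R}^2:\ \theta>0,\ W\in\mathbb{R},\ (\theta,W)\ne(\theta_\gamma,0)\}$. Put $E_\gamma(\theta,W)=\frac{d}{\gamma}(\cosh\theta-\gamma^{1/2}\sinh\theta)^2+W^2$, $$G_1(\theta,W)=-\frac{\alpha\gamma^{1/2}W}{E_\gamma^{3/2}},\qquad G_2(\theta,W)=-\frac{1}{d^{1/2}}\Big(\frac{\gamma^{3/2}}{\cosh\theta}+\frac{1}{\sinh\theta}\Big)+\frac{\alpha d(\sinh\theta-\gamma^{1/2}\cosh\theta)(\cosh\theta-\gamma^{1/2}\sinh\theta)}{\gamma^{1/2}E_\gamma^{3/2}},$$ $$\mathcal G(\theta,W)=\frac{1}{d^{1/2}}\Big(2\gamma^{3/2}\arctan\big(\tanh(\theta/2)\big)+\log\big(\tanh(\theta/2)\big)\Big)+\frac{\alpha\gamma^{1/2}}{E_\gamma^{1/2}}.$$ Solutions of the system with data in $\Omega_\gamma$ exist for all $t\in\mathbb{R}$. A solution is called a leapfrogging solution if it is non-constant and periodic and its orbit $\{(\theta(t),W(t)):t\in\mathbb{R}\}$ is a closed curve in $\Omega_\gamma$ revolving around $(\theta_\gamma,0)$, i.e. $(\theta_\gamma,0)$ lies in the bounded component of the complement of the orbit in $\mathbb{R}^2$. (The system models two coaxial circular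 vortex filaments with vorticities of opposite sign, of radii $(d/\gamma)^{1/2}\cosh\theta$ and $d^{1/2}\sinh\theta$ and axial separation $W$.) *)

(* Defs.v *)
From Stdlib Require Import Reals.
Open Scope R_scope.

Definition artanh (x : R) : R := / 2 * ln ((1 + x) / (1 - x)).

Definition theta_g (g : R) : R := artanh (/ sqrt g).

Definition Omega (g th W : R) : Prop :=
  0 < th /\ ~ (th = theta_g g /\ W = 0).

Definition Eg (d g th W : R) : R :=
  d / g * (cosh th - sqrt g * sinh th) ^ 2 + W ^ 2.

Definition pow32 (y : R) : R := y * sqrt y.

Definition G1 (al d g th W : R) : R :=
  - (al * sqrt g * W / pow32 (Eg d g th W)).

Definition G2 (al d g th W : R) : R :=
  - (/ sqrt d) * (pow32 g / cosh th + / sinh th)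
  + al * d * (sinh th - sqrt g * cosh th) * (cosh th - sqrt g * sinh th)
    / (sqrt g * pow32 (Eg d g th W)).

(* the conserved quantity \mathcal G *)
Definition Gc (al d g th W : R) : R :=
  / sqrt d * (2 * pow32 g * atan (tanh (th / 2)) + ln (tanh (th / 2)))
  + al * sqrt g / sqrt (Eg d g th W).

Definition equilibrium (al d g th W : R) : Prop :=
  Omega g th W /\ G1 al d g th W = 0 /\ G2 al d g th W = 0.

Definition is_solution (al d g : R) (th W : R -> R) : Prop :=
  forall t, Omega g (th t) (W t) /\
    derivable_pt_lim th t (G1 al d g (th t) (W t)) /\
    derivable_pt_lim W t (G2 al d g (th t) (W t)).

Definition dist2 (p q : R * R) : R :=
  sqrt ((fst p - fst q) ^ 2 + (snd p - snd q) ^ 2).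

Definition open2 (U : R * R -> Prop) : Prop :=
  forall p, U p -> exists eps, 0 < eps /\ forall q, dist2 p q < eps -> U q.

Definition connected2 (S : R * R -> Prop) : Prop :=
  forall U V : R * R -> Prop, open2 U -> open2 V ->
    (forall p, S p -> U p \/ V p) ->
    (forall p, S p -> U p -> V p -> False) ->
    (exists p, S p /\ U p) -> (exists p, S p /\ V p) -> False.

(* p lies in a bounded connected component of the complement of K:
   the connected component of p in R^2 \ K (the union of all connected
   subsets of R^2 \ K containing p) is bounded. *)
Definition in_bounded_component_of_complement (K : R * R -> Prop) (p : R * R) : Prop :=
  ~ K p /\
  exists M, forall S : R * R -> Prop,
    connected2 S -> S p -> (forall q, S q -> ~ K q) ->
    forall q, S q -> dist2 p q <= M.

(* leapfrogging solution: non-constant, periodic, orbit revolving around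
   (theta_gamma, 0). (The orbit of a continuous periodic map is a closed
   curve; it lies in Omega_gamma since the solution does.) *)
Definition leapfrogging (g : R) (th W : R -> R) : Prop :=
  (exists t1 t2, (th t1, W t1) <> (th t2, W t2)) /\
  (exists T, 0 < T /\ forall t, th (t + T) = th t /\ W (t + T) = W t) /\
  in_bounded_component_of_complement
    (fun p => exists t, p = (th t, W t)) (theta_g g, 0).

Definition leap_from (al d g th0 W0 : R) : Prop :=
  (exists th W, is_solution al d g th W /\ th 0 = th0 /\ W 0 = W0) /\
  forall th W, is_solution al d g th W -> th 0 = th0 -> W 0 = W0 ->
    leapfrogging g th W.

(* Main.v *)
(** The system is Hamiltonian with Hamiltonian [Gc]. Put [s = sqrt g], [A = al * g],
    [C = cosh th - s sinh th], [y = s W / sqrt d] and [rho = sqrt (C^2 + y^2)]; up to the factor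
    [/ sqrt d], [Gc] is [ham = F (th) + A / rho], where [F] is increasing.

    On the axis [W = 0], to the right of [theta_g], the derivative of [ham] has the sign of
    [q (tanh th) - A] for an explicit increasing rational function [q], so there is an equilibrium
    iff [A < q 1 = (s^3 + 1) (s - 1)], which defines the threshold.

    Leapfrogging: choose [B > theta_g] such that [ham] is nonincreasing on the axis up to [B] and
    less than [h] at [B]. On the level [ham = h] one has [rho = A / (h - F)], hence [C / rho] is the function
    [kap = C (h - F) / A] of [th] alone. It is strictly decreasing on [(0, B]] and less than [-1] at [B],
    so the polar angle [phi] of [(C, - y)] parametrizes the level by [kap (th) = cos phi]. Along
    solutions [phi' = omega > 0] depends on [phi] only and is 2 PI-periodic. This one-dimensional
    equation is solved by inverting [int dphi / omega], which yields existence, uniqueness and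
    periodicity at once.

    Conversely a non-constant periodic solution has [W = 0] at the maximum and the minimum of [th],
    so the profile of [ham] on the axis takes the value [h] at two points; the maximum is then to the
    right of [theta_g], where [ham] exceeds the claimed bound. *)

Require Import Defs.
From Stdlib Require Import ZArith Reals Lra Psatz ClassicalEpsilon Ranalysis5.
From Coquelicot Require Import Coquelicot.
Open Scope R_scope.

(** * Analysis on the line *)

Lemma MVT_strict_incr (f df : R -> R) (a b : R) :
  a < b -> (forall x, a <= x <= b -> is_derive f x (df x)) ->
  (forall x, a < x < b -> 0 < df x) -> f a < f b.
Proof.
  intros hab hd hp.
  destruct (MVT_cor2 f df a b hab) as [c [hc hc']].
  { intros c hc; apply is_derive_Reals, hd, hc. }
  specialize (hp c hc'). nra.
Qed.

Lemma MVT_incr (f df : R -> R) (a b : R) :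
  a <= b -> (forall x, a <= x <= b -> is_derive f x (df x)) ->
  (forall x, a < x < b -> 0 <= df x) -> f a <= f b.
Proof.
  intros [hab | ->] hd hp; [| lra].
  destruct (MVT_cor2 f df a b hab) as [c [hc hc']].
  { intros c hc; apply is_derive_Reals, hd, hc. }
  specialize (hp c hc'). nra.
Qed.

Lemma derive_zero_const (f : R -> R) :
  (forall x, is_derive f x 0) -> forall x y, f x = f y.
Proof.
  intros hd.
  assert (H : forall x y, x < y -> f x = f y).
  { intros x y hxy.
    destruct (MVT_cor2 f (fun _ => 0) x y hxy) as [c [hc _]].
    { intros c _; apply is_derive_Reals, hd. }
    lra. }
  intros x y. destruct (Rtotal_order x y) as [h | [-> | h]]; auto.
  symmetry; auto.
Qed.

(** Monotonicity of [f] forces continuity of [g] at [v], since [f (g v - r) < v < f (g v + r)] traps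
    [g u] for [u] near [v]. The difference quotient of [g] is then the inverse of one of [f]. *)
Lemma is_derive_inverse (f g : R -> R) (D : R -> Prop) (v l : R) :
  (forall x, D x -> exists e, 0 < e /\ forall y, Rabs (y - x) < e -> D y) ->
  (forall x y, D x -> D y -> x < y -> f x < f y) ->
  (exists e, 0 < e /\ forall u, Rabs (u - v) < e -> D (g u) /\ f (g u) = u) ->
  l <> 0 -> is_derive f (g v) l -> is_derive g v (/ l).
Proof.
  intros hD hf [e0 [he0 hg]] hl hd.
  assert (hv : D (g v) /\ f (g v) = v).
  { apply hg. rewrite Rminus_diag, Rabs_R0; exact he0. }
  assert (hcont : forall e, 0 < e -> exists d, 0 < d /\
            forall u, Rabs (u - v) < d -> Rabs (g u - g v) < e).
  { intros e he. destruct (hD _ (proj1 hv)) as [e1 [he1 h1]].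
    set (r := Rmin e e1 / 2).
    assert (hr : 0 < r /\ r < e /\ r < e1).
    { unfold r. pose proof (Rmin_l e e1). pose proof (Rmin_r e e1).
      assert (0 < Rmin e e1) by (apply Rmin_glb_lt; lra). lra. }
    assert (hm : D (g v - r)).
    { apply h1. replace (g v - r - g v) with (- r) by ring.
      rewrite Rabs_Ropp, Rabs_pos_eq; lra. }
    assert (hp : D (g v + r)).
    { apply h1. replace (g v + r - g v) with r by ring. rewrite Rabs_pos_eq; lra. }
    assert (i1 : f (g v - r) < v) by (rewrite <- (proj2 hv) at 2; apply hf; tauto || lra).
    assert (i2 : v < f (g v + r)) by (rewrite <- (proj2 hv) at 1; apply hf; tauto || lra).
    exists (Rmin e0 (Rmin (v - f (g v - r)) (f (g v + r) - v))).
    split. { repeat apply Rmin_glb_lt; lra. }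
    intros u hu.
    pose proof (Rlt_le_trans _ _ _ hu (Rmin_l _ _)) as hu0.
    pose proof (Rlt_le_trans _ _ _ hu (Rmin_r _ _)) as hu1.
    pose proof (Rlt_le_trans _ _ _ hu1 (Rmin_l _ _)) as hu2.
    pose proof (Rlt_le_trans _ _ _ hu1 (Rmin_r _ _)) as hu3.
    destruct (hg u hu0) as [hDu hfu].
    apply Rabs_def2 in hu2. apply Rabs_def2 in hu3.
    assert (g v - r < g u).
    { destruct (Rlt_le_dec (g v - r) (g u)) as [|[k | k]]; [assumption | | ].
      - pose proof (hf _ _ hDu hm k). lra.
      - rewrite k in hfu. lra. }
    assert (g u < g v + r).
    { destruct (Rlt_le_dec (g u) (g v + r)) as [|[k | k]]; [assumption | | ].
      - pose proof (hf _ _ hp hDu k). lra.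
      - rewrite <- k in hfu. lra. }
    apply Rabs_def1; lra. }
  apply is_derive_Reals in hd. apply is_derive_Reals.
  intros eps heps.
  (* For a difference quotient [q] of [f], the first bound gives [Rabs q > Rabs l / 2]; the second
     then makes the error of the inverse quotient, [Rabs (q - l) / (Rabs q * Rabs l)], less than
     [eps]. *)
  set (e1 := Rmin (Rabs l / 2) (eps * (Rabs l * Rabs l) / 2)).
  assert (hal : 0 < Rabs l) by (apply Rabs_pos_lt; exact hl).
  assert (he1 : 0 < e1).
  { unfold e1. apply Rmin_glb_lt; [lra|].
    apply Rmult_lt_0_compat; [|lra]. repeat apply Rmult_lt_0_compat; lra. }
  destruct (hd e1 he1) as [d1 hd1].
  destruct (hcont d1 (cond_pos d1)) as [d2 [hd2 hd2']].
  assert (hd3 : 0 < Rmin d2 e0) by (apply Rmin_glb_lt; lra).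
  exists (mkposreal _ hd3). intros h hh hhd. simpl in hhd.
  pose proof (Rlt_le_trans _ _ _ hhd (Rmin_l _ _)) as a1.
  pose proof (Rlt_le_trans _ _ _ hhd (Rmin_r _ _)) as a2.
  assert (a3 : Rabs (g (v + h) - g v) < d1).
  { apply hd2'. replace (v + h - v) with h by ring. exact a1. }
  destruct (hg (v + h)) as [b1 b2].
  { replace (v + h - v) with h by ring. exact a2. }
  set (k := g (v + h) - g v) in *.
  assert (hk : k <> 0).
  { intros hk. assert (g (v + h) = g v) by (unfold k in hk; lra).
    rewrite H in b2. rewrite (proj2 hv) in b2. lra. }
  specialize (hd1 k hk a3).
  replace (g v + k) with (g (v + h)) in hd1 by (unfold k; ring).
  rewrite b2, (proj2 hv) in hd1.
  replace (v + h - v) with h in hd1 by ring.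
  set (q := h / k) in *.
  assert (hq : k / h = / q) by (unfold q; field; auto).
  rewrite hq.
  pose proof (Rlt_le_trans _ _ _ hd1 (Rmin_l _ _)) as c1.
  pose proof (Rlt_le_trans _ _ _ hd1 (Rmin_r _ _)) as c2.
  assert (hql : Rabs l / 2 < Rabs q).
  { pose proof (Rabs_triang_inv l (l - q)). replace (l - (l - q)) with q in H by ring.
    rewrite (Rabs_minus_sym l q) in H. lra. }
  assert (hq0 : q <> 0) by (intros E; rewrite E, Rabs_R0 in hql; lra).
  replace (/ q - / l) with (- (q - l) / (q * l)) by (field; auto).
  unfold Rdiv. rewrite Rabs_mult, Rabs_Ropp, Rabs_inv, Rabs_mult.
  apply (Rmult_lt_reg_r (Rabs q * Rabs l)); [nra|].
  rewrite Rmult_assoc, Rinv_l by nra.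
  rewrite Rmult_1_r.
  pose proof (Rmult_lt_0_compat _ _ (Rmult_lt_0_compat _ _ heps hal)
    (proj2 (Rlt_0_minus _ _) hql)). nra.
Qed.

(** The travel time [T x], the integral of [/ om] from 0 to [x], is strictly increasing and onto,
    and [psi] is its inverse. Periodicity of [om] makes every turn last [T (2 * PI)]. Along any
    solution [phi] the difference [T (phi t) - t] is constant, so solutions differ by a time
    shift. *)
Lemma phase_clock (om : R -> R) (M : R) :
  (forall x, continuous om x) -> (forall x, 0 < om x <= M) ->
  (forall x, om (x + 2 * PI) = om x) ->
  exists (psi : R -> R) (T : R), 0 < T /\
    (forall t, is_derive psi t (om (psi t))) /\
    (forall t, psi (t + T) = psi t + 2 * PI) /\
    (forall x, exists t, psi t = x) /\
    (forall phi, (forall t, is_derive phi t (om (phi t))) ->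
       exists tau, forall t, phi t = psi (t + tau)).
Proof.
  intros hc hb hper.
  assert (hci : forall x, continuous (fun x => / om x) x).
  { intros x. apply (continuous_comp om Rinv); [apply hc|].
    apply continuous_Rinv. specialize (hb x); lra. }
  assert (hM : 0 < M) by (specialize (hb 0); lra).
  set (T := fun x => RInt (fun x => / om x) 0 x).
  assert (hT : forall x, is_derive T x (/ om x)).
  { intros x. apply (is_derive_RInt (fun x => / om x) T 0 x).
    - exists (mkposreal 1 Rlt_0_1). intros y _. apply (@RInt_correct R_CompleteNormedModule).
      apply (@ex_RInt_continuous R_CompleteNormedModule). intros; apply hci.
    - apply hci. }
  assert (hTpos : forall x, 0 < / om x).
  { intros x; apply Rinv_0_lt_compat; specialize (hb x); lra. }
  assert (hTinc : forall x y, x < y -> T x < T y).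
  { intros x y hxy. apply (MVT_strict_incr T (fun x => / om x)); auto. }
  assert (hTinj : forall x y, T x = T y -> x = y).
  { intros x y hxy. destruct (Rtotal_order x y) as [h | [h | h]]; auto.
    - pose proof (hTinc _ _ h); lra.
    - pose proof (hTinc _ _ h); lra. }
  (* The upper bound [M] on the speed gives [T] at least linear growth in both directions, hence
     surjectivity. *)
  assert (hTgrow : forall x y, x <= y -> T x - x / M <= T y - y / M).
  { intros x y hxy. apply (MVT_incr (fun x => T x - x / M) (fun x => / om x - 1 / M)); auto.
    - intros z _. apply (is_derive_minus T (fun x => x / M)); [apply hT|].
      auto_derive; auto.
    - intros z _. unfold Rdiv; rewrite Rmult_1_l.
      assert (/ M <= / om z) by (apply Rinv_le_contravar; apply hb). lra. }
  assert (hT0 : T 0 = 0) by (apply (@RInt_point R_CompleteNormedModule)).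
  assert (hTc : continuity T).
  { intros x. apply derivable_continuous_pt. exists (/ om x). apply is_derive_Reals, hT. }
  assert (hinv : forall t, {x | T x = t}).
  { intros t.
    pose (L := M * Rabs t).
    assert (hL : 0 <= L) by (unfold L; apply Rmult_le_pos; [lra | apply Rabs_pos]).
    assert (hLM : L / M = Rabs t) by (unfold L; field; lra).
    destruct (IVT_gen T (- L) L t hTc) as [x [_ hx]]; [|exists x; exact hx].
    assert (e1 : T (- L) <= t).
    { pose proof (hTgrow (- L) 0 ltac:(lra)). unfold Rdiv in *.
      rewrite hT0, Rmult_0_l, <- Ropp_mult_distr_l, hLM in H.
      pose proof (Rle_abs (- t)). rewrite Rabs_Ropp in *. lra. }
    assert (e2 : t <= T L).
    { pose proof (hTgrow 0 L ltac:(lra)). unfold Rdiv in *.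
      rewrite hT0, Rmult_0_l, hLM in H.
      pose proof (Rle_abs t). lra. }
    rewrite Rmin_left, Rmax_right by lra. lra. }
  set (psi := fun t => proj1_sig (hinv t)).
  assert (hpsi : forall t, T (psi t) = t) by (intros t; apply (proj2_sig (hinv t))).
  assert (hpsi' : forall x, psi (T x) = x) by (intros x; apply hTinj, hpsi).
  assert (hTper : forall x, T (x + 2 * PI) = T x + T (2 * PI)).
  { intros x.
    assert (E : T (x + 2 * PI) - T x = T (0 + 2 * PI) - T 0).
    { apply (derive_zero_const (fun x => T (x + 2 * PI) - T x)). intros y.
      replace 0 with (1 * / om (y + 2 * PI) - / om y) by (rewrite hper; ring).
      apply (is_derive_minus (fun x => T (x + 2 * PI)) T); [|apply hT].
      apply (is_derive_comp T (fun x => x + 2 * PI)); [apply hT|].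
      auto_derive; auto. }
    rewrite Rplus_0_l, hT0 in E. lra. }
  exists psi, (T (2 * PI)). split; [|split; [|split; [|split]]].
  - rewrite <- hT0. apply hTinc. pose proof PI_RGT_0; lra.
  - intros t. rewrite <- (Rinv_inv (om (psi t))).
    apply (is_derive_inverse T psi (fun _ => True)); auto.
    + intros x _. exists 1. split; [lra | auto].
    + exists 1. split; [lra | auto].
    + specialize (hTpos (psi t)); lra.
  - intros t. apply hTinj. rewrite hTper, !hpsi. reflexivity.
  - intros x. exists (T x). apply hpsi'.
  - intros phi hphi. exists (T (phi 0)). intros t. apply hTinj. rewrite hpsi.
    assert (E : T (phi t) - t = T (phi 0) - 0).
    { apply (derive_zero_const (fun t => T (phi t) - t)). intros u.
      replace 0 with (om (phi u) * / om (phi u) - 1)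
        by (field; specialize (hb (phi u)); lra).
      apply (is_derive_minus (fun t => T (phi t)) (fun t => t)).
      - apply (is_derive_comp T phi); auto.
      - apply (is_derive_id u). }
    lra.
Qed.

(* The indicator of one of two disjoint open sets covering the line is locally constant. *)
Lemma vertical_line_connected (a : R) : connected2 (fun p => fst p = a).
Proof.
  intros U V hU hV hcov hdis [[p1 p2] [hp pU]] [[q1 q2] [hq qV]].
  simpl in hp, hq; subst p1 q1.
  set (f := fun y => if excluded_middle_informative (U (a, y)) then 0 else 1).
  assert (hdist : forall x y, dist2 (a, x) (a, y) = Rabs (y - x)).
  { intros x y. unfold dist2; simpl fst; simpl snd.
    replace ((a - a) ^ 2 + (x - y) ^ 2) with ((y - x)²) by (unfold Rsqr; ring).
    apply sqrt_Rsqr_abs. }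
  assert (hf1 : forall y, U (a, y) -> f y = 0).
  { intros y h. unfold f. destruct excluded_middle_informative; tauto. }
  assert (hf2 : forall y, V (a, y) -> f y = 1).
  { intros y h. unfold f. destruct excluded_middle_informative as [n|n]; [|tauto].
    destruct (hdis (a, y) eq_refl n h). }
  assert (hf : forall y, is_derive f y 0).
  { intros y.
    assert (hloc : locally y (fun z => f y = f z)).
    { destruct (classic (U (a, y))) as [hy | hy].
      - destruct (hU _ hy) as [e [he h]]. exists (mkposreal e he). intros z hz.
        rewrite !hf1; [reflexivity | | exact hy].
        apply h. rewrite hdist. exact hz.
      - destruct (hcov (a, y) eq_refl) as [|hy']; [contradiction|].
        destruct (hV _ hy') as [e [he h]]. exists (mkposreal e he). intros z hz.
        rewrite !hf2; [reflexivity | | exact hy'].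
        apply h. rewrite hdist. exact hz. }
    apply (is_derive_ext_loc (fun _ => f y)); auto.
    apply (@is_derive_const R_AbsRing). }
  pose proof (derive_zero_const f hf p2 q2) as E.
  rewrite (hf1 p2 pU), (hf2 q2 qV) in E. lra.
Qed.

(** * The potential and the angular coordinate *)

(** With [s = sqrt g], [cc] is the base of the square in [Eg] and [dcc] its derivative; [Fpot] is
    the first summand of [Gc] multiplied by [sqrt d]. *)
Definition cc (s x : R) : R := cosh x - s * sinh x.
Definition dcc (s x : R) : R := sinh x - s * cosh x.
Definition Fpot (s x : R) : R := 2 * s ^ 3 * atan (tanh (x / 2)) + ln (tanh (x / 2)).
Definition dFpot (s x : R) : R := s ^ 3 / cosh x + / sinh x.

Lemma cosh_pos (x : R) : 0 < cosh x.
Proof. unfold cosh. pose proof (exp_pos x). pose proof (exp_pos (- x)). lra. Qed.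

Lemma sinh_pos (x : R) : 0 < x -> 0 < sinh x.
Proof.
  intros hx. unfold sinh. pose proof (exp_increasing (- x) x ltac:(lra)). lra.
Qed.

Lemma sinh_lt_cosh (x : R) : sinh x < cosh x.
Proof. unfold sinh, cosh. pose proof (exp_pos (- x)). lra. Qed.

Lemma cosh2_sinh2 (x : R) : cosh x ^ 2 - sinh x ^ 2 = 1.
Proof.
  unfold sinh, cosh. assert (exp x * exp (- x) = 1) by (rewrite exp_Ropp; field; pose proof (exp_pos x); lra).
  nra.
Qed.

Lemma cosh_half (x : R) : cosh x = cosh (x / 2) ^ 2 + sinh (x / 2) ^ 2.
Proof.
  unfold sinh, cosh.
  replace (exp x) with (exp (x / 2) * exp (x / 2)) by (rewrite <- exp_plus; f_equal; field).
  replace (exp (- x)) with (exp (- (x / 2)) * exp (- (x / 2))) by (rewrite <- exp_plus; f_equal; field).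
  field.
Qed.

Lemma sinh_half (x : R) : sinh x = 2 * sinh (x / 2) * cosh (x / 2).
Proof.
  unfold sinh, cosh.
  replace (exp x) with (exp (x / 2) * exp (x / 2)) by (rewrite <- exp_plus; f_equal; field).
  replace (exp (- x)) with (exp (- (x / 2)) * exp (- (x / 2))) by (rewrite <- exp_plus; f_equal; field).
  field.
Qed.

Lemma dcc_neg (s x : R) : 1 < s -> dcc s x < 0.
Proof.
  intros hs. unfold dcc. pose proof (sinh_lt_cosh x). pose proof (cosh_pos x). nra.
Qed.

Lemma dFpot_pos (s x : R) : 1 < s -> 0 < x -> 0 < dFpot s x.
Proof.
  intros hs hx. unfold dFpot. pose proof (cosh_pos x). pose proof (sinh_pos x hx).
  assert (0 < s ^ 3) by (apply pow_lt; lra).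
  apply Rplus_lt_0_compat; [apply Rdiv_lt_0_compat | apply Rinv_0_lt_compat]; assumption.
Qed.

Lemma is_derive_cc (s x : R) : is_derive (cc s) x (dcc s x).
Proof. unfold cc, dcc. auto_derive; auto. ring. Qed.

Lemma is_derive_dcc (s x : R) : is_derive (dcc s) x (cc s x).
Proof. unfold cc, dcc. auto_derive; auto. ring. Qed.

Lemma is_derive_Fpot (s x : R) : 0 < x -> is_derive (Fpot s) x (dFpot s x).
Proof.
  intros hx.
  pose proof (cosh_pos (x / 2)) as hc. pose proof (sinh_pos (x / 2) ltac:(lra)) as hs.
  unfold Fpot, dFpot, tanh. auto_derive.
  - repeat split; try lra. apply Rdiv_lt_0_compat; assumption.
  - rewrite (cosh_half x), (sinh_half x). unfold Rsqr, Rdiv in *.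
    pose proof (cosh2_sinh2 (x * / 2)) as hcs.
    set (c := cosh (x * / 2)) in *. set (t := sinh (x * / 2)) in *.
    assert (0 < c ^ 2 + t ^ 2) by nra.
    replace (1 * / 2 * t) with (t / 2) by field.
    (* The identity holds only modulo [c ^ 2 - t ^ 2 = 1]; inserting this factor on the right makes
       it homogeneous, so that [field] proves it. *)
    assert (E : forall a b : R, a = b * (c ^ 2 - t ^ 2) -> a = b) by (intros a b ->; rewrite hcs; ring).
    apply E. field. repeat split; nra.
Qed.

Lemma is_derive_dFpot (s x : R) : 0 < x ->
  is_derive (dFpot s) x (- (s ^ 3 * sinh x / cosh x ^ 2 + cosh x / sinh x ^ 2)).
Proof.
  intros hx. pose proof (cosh_pos x). pose proof (sinh_pos x hx).
  unfold dFpot. auto_derive; [repeat split; lra|]. field. lra.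
Qed.

Lemma cc_decr (s x y : R) : 1 < s -> x < y -> cc s y < cc s x.
Proof.
  intros hs hxy. apply Ropp_lt_cancel.
  apply (MVT_strict_incr (fun x => - cc s x) (fun x => - dcc s x)); auto.
  - intros z _. apply (is_derive_opp (cc s)), is_derive_cc.
  - intros z _. pose proof (dcc_neg s z hs). lra.
Qed.

Lemma artanh_pos (u : R) : 0 < u < 1 -> 0 < artanh u.
Proof.
  intros hu. unfold artanh. apply Rmult_lt_0_compat; [lra|].
  rewrite <- ln_1. apply ln_increasing; [lra|].
  apply (Rmult_lt_reg_r (1 - u)); [lra|].
  unfold Rdiv; rewrite Rmult_assoc, Rinv_l; lra.
Qed.

(** At this point [exp (2 * x) = (s + 1) / (s - 1)], which is the equation [cc s x = 0] multiplied
    by [2 * exp x]. *)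
Lemma cc_artanh (s : R) : 1 < s -> cc s (artanh (/ s)) = 0.
Proof.
  intros hs.
  assert (hu : 0 < / s < 1).
  { split; [apply Rinv_0_lt_compat; lra|]. rewrite <- Rinv_1. apply Rinv_lt_contravar; lra. }
  unfold cc, artanh. set (v := (1 + / s) / (1 - / s)).
  assert (hv : 0 < v) by (unfold v; apply Rdiv_lt_0_compat; lra).
  set (x := / 2 * ln v).
  assert (E : exp x * exp x = v).
  { rewrite <- exp_plus. unfold x. replace (/ 2 * ln v + / 2 * ln v) with (ln v) by field.
    apply exp_ln; exact hv. }
  assert (Ev : v * (s - 1) = s + 1) by (unfold v; field; lra).
  unfold cosh, sinh. pose proof (exp_pos x).
  rewrite exp_Ropp.
  assert (E' : forall a, a * exp x = 0 -> a = 0) by (intros a h; nra).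
  apply E'. field_simplify; [|lra]. replace (exp x ^ 2) with v by (rewrite <- E; ring). nra.
Qed.

(* [dFpot * cc ^ 2 / (- dcc)] in the variable [u = tanh x]; on the axis, stationary points of
   the Hamiltonian to the right of the zero of [cc] are the solutions of [qfun s (tanh x) = A]. *)
Definition qfun (s u : R) : R := (s ^ 3 * u + 1) * (s - / u) * (s * u - 1) * / (s - u).

Lemma qfun_tanh (s x : R) : 1 < s -> 0 < x ->
  dFpot s x * cc s x ^ 2 = qfun s (tanh x) * - dcc s x.
Proof.
  intros hs hx. pose proof (cosh_pos x). pose proof (sinh_pos x hx).
  pose proof (sinh_lt_cosh x).
  unfold dFpot, cc, dcc, qfun, tanh. field. repeat split; nra.
Qed.

(** On [(/ s, 1]] each of the four factors is positive and strictly increasing; they are multiplied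
    up one at a time. *)
Lemma qfun_incr (s u v : R) : 1 < s -> / s < u -> u < v -> v <= 1 -> qfun s u < qfun s v.
Proof.
  intros hs hu huv hv.
  assert (hs0 : 0 < / s) by (apply Rinv_0_lt_compat; lra).
  assert (hsu : 1 < s * u).
  { replace 1 with (s * / s) by (field; lra). apply Rmult_lt_compat_l; lra. }
  assert (hiu : / u < s).
  { apply (Rmult_lt_reg_r u); [lra|]. rewrite Rinv_l; lra. }
  assert (hiv : / v < / u) by (apply Rinv_lt_contravar; nra).
  assert (hi : / (s - u) < / (s - v)) by (apply Rinv_lt_contravar; nra).
  assert (h0 : 0 < / (s - u)) by (apply Rinv_0_lt_compat; lra).
  assert (hs3 : 0 < s ^ 3) by (apply pow_lt; lra).
  unfold qfun.
  assert (k1 : 0 < (s ^ 3 * u + 1) < s ^ 3 * v + 1) by nra.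
  assert (k2 : 0 < (s ^ 3 * u + 1) * (s - / u) < (s ^ 3 * v + 1) * (s - / v)) by nra.
  assert (k3 : 0 < (s ^ 3 * u + 1) * (s - / u) * (s * u - 1) <
               (s ^ 3 * v + 1) * (s - / v) * (s * v - 1)).
  { assert (0 < s * u - 1 < s * v - 1) by nra.
    set (p := (s ^ 3 * u + 1) * (s - / u)) in *. set (p' := (s ^ 3 * v + 1) * (s - / v)) in *. nra. }
  set (p := (s ^ 3 * u + 1) * (s - / u) * (s * u - 1)) in *.
  set (p' := (s ^ 3 * v + 1) * (s - / v) * (s * v - 1)) in *.
  nra.
Qed.

Lemma tanh_lt_1 (x : R) : tanh x < 1.
Proof.
  unfold tanh. pose proof (cosh_pos x). pose proof (sinh_lt_cosh x).
  apply (Rmult_lt_reg_r (cosh x)); [lra|]. unfold Rdiv. rewrite Rmult_assoc, Rinv_l; lra.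
Qed.

Lemma tanh_gt_inv (s x : R) : 1 < s -> cc s x < 0 -> / s < tanh x.
Proof.
  intros hs hx. unfold cc in hx. pose proof (cosh_pos x).
  unfold tanh. apply (Rmult_lt_reg_r (s * cosh x)); [nra|].
  field_simplify; lra.
Qed.

Lemma is_derive_tanh (x : R) : is_derive tanh x (1 - tanh x ^ 2).
Proof.
  pose proof (cosh_pos x). unfold tanh. auto_derive; [lra|]. field. lra.
Qed.

Lemma tanh_incr (x y : R) : x < y -> tanh x < tanh y.
Proof.
  intros h. apply (MVT_strict_incr tanh (fun x => 1 - tanh x ^ 2)); auto.
  - intros; apply is_derive_tanh.
  - intros z _. pose proof (cosh_pos z). pose proof (cosh2_sinh2 z).
    unfold tanh. replace (1 - (sinh z / cosh z) ^ 2) with ((cosh z ^ 2 - sinh z ^ 2) / cosh z ^ 2) by (field; lra).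
    rewrite H0. apply Rdiv_lt_0_compat; [lra | apply pow_lt; lra].
Qed.

Lemma Fpot_lt (s x y : R) : 1 < s -> 0 < x -> x < y -> Fpot s x < Fpot s y.
Proof.
  intros hs hx hxy. apply (MVT_strict_incr (Fpot s) (dFpot s)); auto.
  - intros z hz; apply is_derive_Fpot; lra.
  - intros z hz; apply dFpot_pos; lra.
Qed.

(* The derivative is nonnegative because [r = cc / dcc] satisfies [0 <= r <= tanh x]. *)
Lemma Fpot_plus_incr (s x y : R) : 1 < s -> 0 < x -> x <= y -> cc s x <= 0 ->
  Fpot s x + dFpot s x * (cc s x / dcc s x) <= Fpot s y + dFpot s y * (cc s y / dcc s y).
Proof.
  intros hs hx hxy hc.
  set (ddF := fun x => - (s ^ 3 * sinh x / cosh x ^ 2 + cosh x / sinh x ^ 2)).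
  apply (MVT_incr (fun x => Fpot s x + dFpot s x * (cc s x / dcc s x))
    (fun x => dFpot s x + (ddF x * (cc s x / dcc s x) +
       dFpot s x * ((dcc s x * dcc s x - cc s x * cc s x) / dcc s x ^ 2)))); auto.
  - intros z hz. pose proof (dcc_neg s z hs).
    apply (is_derive_plus (Fpot s) (fun x => dFpot s x * (cc s x / dcc s x)));
      [apply is_derive_Fpot; lra|].
    apply (Derive.is_derive_mult (dFpot s) (fun x => cc s x / dcc s x));
      [apply is_derive_dFpot; lra|].
    apply (is_derive_div (cc s) (dcc s)); [apply is_derive_cc | apply is_derive_dcc | lra].
  - intros z hz. pose proof (dcc_neg s z hs) as hd.
    assert (hcz : cc s z < 0) by (pose proof (cc_decr s x z hs ltac:(lra)); lra).
    pose proof (cosh_pos z) as h1. pose proof (sinh_pos z ltac:(lra)) as h2.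
    pose proof (sinh_lt_cosh z) as h3.
    pose proof (dFpot_pos s z hs ltac:(lra)) as hF.
    set (r := cc s z / dcc s z).
    assert (hr0 : 0 < r).
    { unfold r. replace (cc s z / dcc s z) with ((- cc s z) / (- dcc s z)) by (field; lra).
      apply Rdiv_lt_0_compat; lra. }
    assert (hrd : r * dcc s z = cc s z) by (unfold r; field; lra).
    assert (hrt : r * cosh z <= sinh z).
    { unfold cc, dcc in hrd, hd. nra. }
    assert (hr1 : r < 1) by nra.
    replace ((dcc s z * dcc s z - cc s z * cc s z) / dcc s z ^ 2) with (1 - r * r)
      by (unfold r; field; lra).
    assert (key : - ddF z * r <= dFpot s z).
    { unfold ddF, dFpot. rewrite Ropp_involutive, Rmult_plus_distr_r.
      assert (hs3 : 0 < s ^ 3) by (apply pow_lt; lra).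
      apply Rplus_le_compat.
      - unfold Rdiv. rewrite !Rmult_assoc. apply Rmult_le_compat_l; [lra|].
        apply (Rmult_le_reg_r (cosh z ^ 2)); [apply pow_lt; lra|].
        replace (sinh z * (/ cosh z ^ 2 * r) * cosh z ^ 2) with (sinh z * r) by (field; lra).
        replace (/ cosh z * cosh z ^ 2) with (cosh z) by (field; lra). nra.
      - apply (Rmult_le_reg_r (sinh z ^ 2)); [apply pow_lt; lra|].
        replace (cosh z / sinh z ^ 2 * r * sinh z ^ 2) with (r * cosh z) by (field; lra).
        replace (/ sinh z * sinh z ^ 2) with (sinh z) by (field; lra). lra. }
    assert (0 <= dFpot s z * (1 - r * r)) by (apply Rmult_le_pos; nra).
    lra.
Qed.

(** * The cosine of the polar angle along a level *)

Definition kap (s A h x : R) : R := cc s x * (h - Fpot s x) / A.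
Definition dkap (s A h x : R) : R :=
  (dcc s x * (h - Fpot s x) - cc s x * dFpot s x) / A.

Lemma is_derive_kap (s A h x : R) : 0 < x -> is_derive (kap s A h) x (dkap s A h x).
Proof.
  intros hx. unfold kap, dkap.
  replace ((dcc s x * (h - Fpot s x) - cc s x * dFpot s x) / A)
    with (/ A * (dcc s x * (h - Fpot s x) + cc s x * (0 - dFpot s x)))
    by (unfold Rdiv; ring).
  apply (is_derive_ext (fun x => / A * (cc s x * (h - Fpot s x)))).
  { intros; unfold Rdiv; rewrite Rmult_comm; reflexivity. }
  apply is_derive_scal.
  apply (Derive.is_derive_mult (cc s) (fun x => h - Fpot s x)); [apply is_derive_cc|].
  apply (is_derive_minus (fun _ => h) (Fpot s)); [apply (@is_derive_const R_AbsRing)|].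
  apply is_derive_Fpot; exact hx.
Qed.

(* The part of the level [h] of the Hamiltonian to the left of [B] is a closed curve: the fifth
   condition says that the Hamiltonian is nonincreasing at [B] on the axis, the last one that it
   is less than [h] there. *)
Definition window (s A B h : R) : Prop :=
  1 < s /\ 0 < A /\ 0 < B /\ cc s B < 0 /\
  dFpot s B * cc s B ^ 2 <= A * - dcc s B /\ Fpot s B + A / - cc s B < h.

Lemma window_pot_lt (s A B h x : R) : window s A B h -> 0 < x <= B -> Fpot s x < h.
Proof.
  intros [hs [hA [hB [hc [_ hh]]]]] [hx [hxB | ->]].
  - pose proof (Fpot_lt s x B hs hx hxB).
    assert (0 < A / - cc s B) by (apply Rdiv_lt_0_compat; lra). lra.
  - assert (0 < A / - cc s B) by (apply Rdiv_lt_0_compat; lra). lra.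
Qed.

(** Where [cc] is nonnegative both terms of the numerator have the right sign. Where it is negative
    the claim becomes [Fpot + dFpot * (cc / dcc) < h]; the left side is nondecreasing, and at [B]
    the window conditions bound it by [Fpot s B + A / - cc s B < h]. *)
Lemma dkap_neg (s A B h x : R) : window s A B h -> 0 < x <= B -> dkap s A h x < 0.
Proof.
  intros hw hx. pose proof (window_pot_lt _ _ _ _ _ hw hx) as hF.
  destruct hw as [hs [hA [hB [hc [hf hh]]]]].
  pose proof (dcc_neg s x hs) as hd. pose proof (dFpot_pos s x hs (proj1 hx)) as hp.
  assert (E : dcc s x * (h - Fpot s x) - cc s x * dFpot s x < 0).
  { destruct (Rle_lt_dec 0 (cc s x)) as [h0 | h0]; [nra|].
    pose proof (Fpot_plus_incr s x B hs (proj1 hx) (proj2 hx) ltac:(lra)) as hm.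
    pose proof (dcc_neg s B hs) as hdB.
    assert (k : dFpot s B * (cc s B / dcc s B) <= A / - cc s B).
    { apply (Rmult_le_reg_r (- cc s B * - dcc s B)); [nra|].
      replace (dFpot s B * (cc s B / dcc s B) * (- cc s B * - dcc s B))
        with (dFpot s B * cc s B ^ 2) by (field; lra).
      replace (A / - cc s B * (- cc s B * - dcc s B)) with (A * - dcc s B) by (field; lra).
      exact hf. }
    assert (k2 : dFpot s x * (cc s x / dcc s x) < h - Fpot s x) by lra.
    apply (Rmult_lt_compat_r (- dcc s x)) in k2; [|lra].
    replace (dFpot s x * (cc s x / dcc s x) * - dcc s x)
      with (- (cc s x * dFpot s x)) in k2 by (field; lra).
    lra. }
  unfold dkap. apply Ropp_lt_cancel. rewrite Ropp_0.
  unfold Rdiv. rewrite Ropp_mult_distr_l.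
  apply Rmult_lt_0_compat; [lra | apply Rinv_0_lt_compat; lra].
Qed.

Lemma kap_decr (s A B h x y : R) : window s A B h -> 0 < x -> x < y -> y <= B ->
  kap s A h y < kap s A h x.
Proof.
  intros hw hx hxy hy. apply Ropp_lt_cancel.
  apply (MVT_strict_incr (fun x => - kap s A h x) (fun x => - dkap s A h x)); auto.
  - intros z hz. apply (is_derive_opp (kap s A h)), is_derive_kap. lra.
  - intros z hz. pose proof (dkap_neg s A B h z hw ltac:(lra)). lra.
Qed.

Lemma kap_window (s A B h : R) : window s A B h -> kap s A h B < -1.
Proof.
  intros [hs [hA [hB [hc [_ hh]]]]]. unfold kap.
  apply (Rmult_lt_reg_r A); [lra|]. unfold Rdiv. rewrite Rmult_assoc, Rinv_l by lra.
  assert (A / - cc s B * - cc s B = A) by (field; lra).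
  nra.
Qed.

(** * The rescaled system and its angle variable *)

Lemma tanh_pos (x : R) : 0 < x -> 0 < tanh x.
Proof. intros h. apply Rdiv_lt_0_compat; [apply sinh_pos; exact h | apply cosh_pos]. Qed.

Lemma tanh_le (x : R) : 0 <= x -> tanh x <= x.
Proof.
  intros hx. assert (E : tanh 0 = 0) by (unfold tanh; rewrite sinh_0; unfold Rdiv; ring).
  cut (0 - tanh 0 <= x - tanh x); [lra|].
  apply (MVT_incr (fun x => x - tanh x) (fun x => 1 - (1 - tanh x ^ 2))); auto.
  - intros z _. apply (is_derive_minus (fun x => x) tanh); [apply (is_derive_id z) | apply is_derive_tanh].
  - intros z _. nra.
Qed.

Lemma Fpot_unbounded_below (s M e : R) : 1 < s -> 0 < e ->
  exists x, 0 < x < e /\ Fpot s x < M.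
Proof.
  intros hs he.
  (* The arctangent term is below [s ^ 3 * PI], so it suffices to push the logarithm below [m],
     using [tanh (x / 2) <= x / 2 < exp m]. *)
  pose (m := M - s ^ 3 * PI). pose proof (exp_pos m) as hm.
  assert (hs3 : 0 < s ^ 3) by (apply pow_lt; lra).
  exists (Rmin (e / 2) (exp m)).
  assert (h0 : 0 < Rmin (e / 2) (exp m)) by (apply Rmin_glb_lt; lra).
  pose proof (Rmin_l (e / 2) (exp m)). pose proof (Rmin_r (e / 2) (exp m)).
  split; [lra|].
  set (x := Rmin (e / 2) (exp m)) in *. unfold Fpot.
  pose proof (tanh_pos (x / 2) ltac:(lra)). pose proof (tanh_le (x / 2) ltac:(lra)).
  assert (ln (tanh (x / 2)) < m).
  { rewrite <- (ln_exp m). apply ln_increasing; lra. }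
  pose proof (atan_bound (tanh (x / 2))) as [_ hb].
  unfold m in *. nra.
Qed.

Lemma continuity_pt_derive (f : R -> R) (x l : R) : is_derive f x l -> continuity_pt f x.
Proof.
  intros h. apply derivable_continuous_pt. exists l. apply is_derive_Reals, h.
Qed.

(** Near 0 the factor [cc] stays away from 0 while [Fpot] tends to minus infinity, so [kap] takes
    arbitrarily large values; the intermediate value theorem does the rest. *)
Lemma kap_onto (s A B h v : R) : 1 < s -> 0 < A -> 0 < B -> cc s B <= 0 ->
  kap s A h B < v -> exists x, 0 < x < B /\ kap s A h x = v.
Proof.
  intros hs hA hB hc hv.
  (* Since [cc] is 1 at 0 and at most 0 at [B], it equals 1/2 at some [x1] and is larger to the left
     of it. *)
  destruct (IVT_interv (fun x => / 2 - cc s x) 0 B) as [x1 [h1 h1']]; try lra.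
  { intros x _. apply (continuity_pt_derive _ _ (0 - dcc s x)).
    apply (is_derive_minus (fun _ => / 2) (cc s)); [apply (@is_derive_const R_AbsRing)|].
    apply is_derive_cc. }
  { unfold cc. rewrite cosh_0, sinh_0. lra. }
  assert (x1 <> 0) by (intros E; rewrite E in h1'; unfold cc in h1'; rewrite cosh_0, sinh_0 in h1'; lra).
  destruct (Fpot_unbounded_below s (h - 2 * A * (Rabs v + 1)) x1) as [x0 [h0 hF]]; try lra.
  pose proof (cc_decr s x0 x1 hs ltac:(lra)) as hc0.
  pose proof (Rabs_pos v) as hav.
  assert (k0 : v < kap s A h x0).
  { unfold kap. apply (Rmult_lt_reg_r A); [lra|]. unfold Rdiv. rewrite Rmult_assoc, Rinv_l, Rmult_1_r by lra.
    pose proof (Rle_abs v).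
    assert (/ 2 * (2 * A * (Rabs v + 1)) < cc s x0 * (h - Fpot s x0)) by (apply Rmult_gt_0_lt_compat; nra).
    nra. }
  destruct (IVT_interv (fun x => v - kap s A h x) x0 B) as [x [hx hx']]; try lra.
  { intros x hx. apply (continuity_pt_derive _ _ (0 - dkap s A h x)).
    apply (is_derive_minus (fun _ => v) (kap s A h)); [apply (@is_derive_const R_AbsRing)|].
    apply is_derive_kap; lra. }
  exists x. split; [|lra]. split; [lra|].
  destruct (proj2 hx) as [|E]; [assumption|]. rewrite E in hx'. lra.
Qed.

Lemma kap_onto_window (s A B h v : R) : window s A B h -> kap s A h B < v ->
  exists x, 0 < x < B /\ kap s A h x = v.
Proof.
  intros [hs [hA [hB [hc _]]]]. apply kap_onto; try assumption. lra.
Qed.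

Lemma kap_inverse (s A B h : R) : window s A B h ->
  exists K : R -> R, forall v, kap s A h B < v ->
    0 < K v < B /\ kap s A h (K v) = v /\ is_derive K v (/ dkap s A h (K v)).
Proof.
  intros hw.
  (* The condition on [v] sits under the existential quantifier so that choice yields a total
     function; for [v] at most [kap s A h B] its value is arbitrary. *)
  assert (hK : forall v, exists x, kap s A h B < v -> 0 < x < B /\ kap s A h x = v).
  { intros v. destruct (Rlt_dec (kap s A h B) v) as [hv | hv].
    - destruct (kap_onto_window _ _ _ _ _ hw hv) as [x hx]. exists x. auto.
    - exists 0. tauto. }
  pose (K := fun v => proj1_sig (constructive_indefinite_description _ (hK v))).
  assert (hK' : forall v, kap s A h B < v -> 0 < K v < B /\ kap s A h (K v) = v).
  { intros v. exact (proj2_sig (constructive_indefinite_description _ (hK v))). }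
  clearbody K.
  exists K. intros v hv. split; [apply hK'; exact hv | split; [apply hK'; exact hv|]].
  destruct (hK' v hv) as [hx hx'].
  pose proof (dkap_neg s A B h (K v) hw ltac:(lra)) as hd.
  (* The inverse rule is stated for increasing functions, so it is applied to [- kap] and to
     [v |-> K (- v)]. *)
  apply (is_derive_ext (fun v => K (- - v))); [intros; rewrite Ropp_involutive; reflexivity|].
  replace (/ dkap s A h (K v)) with (-1 * / - dkap s A h (K v)) by (field; lra).
  apply (is_derive_comp (fun v => K (- v)) (fun v => - v)); [|auto_derive; auto; ring].
  apply (is_derive_inverse (fun x => - kap s A h x) (fun v => K (- v)) (fun x => 0 < x < B)).
  - intros x hxB. exists (Rmin x (B - x)). split; [apply Rmin_glb_lt; lra|].
    intros y hy. pose proof (Rmin_l x (B - x)). pose proof (Rmin_r x (B - x)).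
    apply Rabs_def2 in hy. lra.
  - intros x y hxB hyB hxy. pose proof (kap_decr s A B h x y hw ltac:(lra) hxy ltac:(lra)). lra.
  - exists (v - kap s A h B). split; [lra|]. intros u hu. apply Rabs_def2 in hu.
    destruct (hK' (- u)) as [a b]; [lra|]. split; [exact a | lra].
  - lra.
  - rewrite Ropp_involutive. apply (is_derive_opp (kap s A h)). apply is_derive_kap. lra.
Qed.

(** The angle is the integral of the speed from a suitable initial value. Both
    [c * cos phi + sg * sin phi] and [c ^ 2 + sg ^ 2] are constant and equal to 1, so the squared
    distance between [(c, sg)] and [(cos phi, sin phi)] is [1 + 1 - 2 = 0]. *)
Lemma angle_lift (c sg om : R -> R) :
  (forall t, is_derive c t (- (sg t * om t))) ->
  (forall t, is_derive sg t (c t * om t)) ->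
  (forall t, continuous om t) -> c 0 ^ 2 + sg 0 ^ 2 = 1 ->
  exists phi, (forall t, is_derive phi t (om t)) /\
    forall t, c t = cos (phi t) /\ sg t = sin (phi t).
Proof.
  intros hc hs hom h0.
  assert (hphi0 : exists p, cos p = c 0 /\ sin p = sg 0).
  { assert (hb : -1 <= c 0 <= 1) by nra.
    assert (e : 1 - (c 0)² = sg 0 ^ 2) by (unfold Rsqr; lra).
    (* The sign of [sg 0] selects the branch of the arccosine. *)
    destruct (Rle_lt_dec 0 (sg 0)) as [h | h].
    - exists (acos (c 0)). rewrite cos_acos, sin_acos by exact hb. split; [reflexivity|].
      rewrite e. apply sqrt_pow2; exact h.
    - exists (- acos (c 0)). rewrite cos_neg, sin_neg, cos_acos, sin_acos by exact hb.
      split; [reflexivity|]. rewrite e.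
      replace (sg 0 ^ 2) with ((- sg 0) ^ 2) by ring. rewrite sqrt_pow2; lra. }
  destruct hphi0 as [p [hp1 hp2]].
  pose (phi := fun t => p + RInt om 0 t).
  assert (hd : forall t, is_derive phi t (om t)).
  { intros t. replace (om t) with (0 + om t) by ring.
    apply (is_derive_plus (fun _ => p) (fun t => RInt om 0 t)); [apply (@is_derive_const R_AbsRing)|].
    apply (is_derive_RInt om (fun t => RInt om 0 t) 0 t); [|apply hom].
    exists (mkposreal 1 Rlt_0_1). intros y _. apply (@RInt_correct R_CompleteNormedModule).
    apply (@ex_RInt_continuous R_CompleteNormedModule). intros; apply hom. }
  assert (hphi : phi 0 = p).
  { unfold phi. rewrite (@RInt_point R_CompleteNormedModule). apply Rplus_0_r. }
  assert (hdc : forall t, is_derive (fun t => cos (phi t)) t (om t * - sin (phi t))).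
  { intros t. apply (is_derive_comp cos phi); [|apply hd]. auto_derive; auto; ring. }
  assert (hds : forall t, is_derive (fun t => sin (phi t)) t (om t * cos (phi t))).
  { intros t. apply (is_derive_comp sin phi); [|apply hd]. auto_derive; auto; ring. }
  exists phi. split; [exact hd|]. intros t.
  assert (E1 : c t * cos (phi t) + sg t * sin (phi t) = c 0 * cos (phi 0) + sg 0 * sin (phi 0)).
  { apply (derive_zero_const (fun t => c t * cos (phi t) + sg t * sin (phi t))). intros u.
    replace 0 with ((- (sg u * om u) * cos (phi u) + c u * (om u * - sin (phi u))) +
      (c u * om u * sin (phi u) + sg u * (om u * cos (phi u)))) by ring.
    apply (is_derive_plus (fun t => c t * cos (phi t)) (fun t => sg t * sin (phi t))).
    - apply (Derive.is_derive_mult c (fun t => cos (phi t))); auto.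
    - apply (Derive.is_derive_mult sg (fun t => sin (phi t))); auto. }
  assert (E2 : c t * c t + sg t * sg t = c 0 * c 0 + sg 0 * sg 0).
  { apply (derive_zero_const (fun t => c t * c t + sg t * sg t)). intros u.
    replace 0 with ((- (sg u * om u) * c u + c u * - (sg u * om u)) +
      (c u * om u * sg u + sg u * (c u * om u))) by ring.
    apply (is_derive_plus (fun t => c t * c t) (fun t => sg t * sg t)).
    - apply (Derive.is_derive_mult c c); auto.
    - apply (Derive.is_derive_mult sg sg); auto. }
  rewrite hphi, hp1, hp2 in E1.
  pose proof (sin2_cos2 (phi t)) as E3. unfold Rsqr in E3.
  assert (E : (c t - cos (phi t)) ^ 2 + (sg t - sin (phi t)) ^ 2 = 0) by nra.
  pose proof (pow2_ge_0 (c t - cos (phi t))). pose proof (pow2_ge_0 (sg t - sin (phi t))).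
  split; apply Rminus_diag_uniq, Rsqr_0_uniq; unfold Rsqr; lra.
Qed.

(* The system in the unknowns [x = theta] and [y = sqrt g * W / sqrt d], with
   [s = sqrt g], [A = al * g] and [k = s / d]. *)
Definition rho (s x y : R) : R := sqrt (cc s x ^ 2 + y ^ 2).
Definition ham (s A x y : R) : R := Fpot s x + A / rho s x y.
Definition red_sol (s A k : R) (X Y : R -> R) : Prop :=
  forall t, 0 < X t /\ 0 < cc s (X t) ^ 2 + Y t ^ 2 /\
    is_derive X t (- (k * A * Y t / rho s (X t) (Y t) ^ 3)) /\
    is_derive Y t (k * (- dFpot s (X t) + A * dcc s (X t) * cc s (X t) / rho s (X t) (Y t) ^ 3)).

Lemma rho_pos (s x y : R) : 0 < cc s x ^ 2 + y ^ 2 -> 0 < rho s x y.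
Proof. apply sqrt_lt_R0. Qed.

Lemma rho_sqr (s x y : R) : rho s x y ^ 2 = cc s x ^ 2 + y ^ 2.
Proof. unfold rho. apply pow2_sqrt. nra. Qed.

Lemma ham_const (s A k : R) (X Y : R -> R) : red_sol s A k X Y ->
  forall t u, ham s A (X t) (Y t) = ham s A (X u) (Y u).
Proof.
  intros hsol. apply (derive_zero_const (fun t => ham s A (X t) (Y t))). intros t.
  destruct (hsol t) as [hX [hr [dX dY]]].
  pose proof (rho_pos _ _ _ hr) as hp.
  set (r := rho s (X t) (Y t)) in *.
  set (x' := - (k * A * Y t / r ^ 3)) in *.
  set (y' := k * (- dFpot s (X t) + A * dcc s (X t) * cc s (X t) / r ^ 3)) in *.
  assert (dc : is_derive (fun t => cc s (X t)) t (x' * dcc s (X t))).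
  { apply (is_derive_comp (cc s) X); [apply is_derive_cc | exact dX]. }
  assert (dF : is_derive (fun t => Fpot s (X t)) t (x' * dFpot s (X t))).
  { apply (is_derive_comp (Fpot s) X); [apply is_derive_Fpot; exact hX | exact dX]. }
  assert (dr : is_derive (fun t => rho s (X t) (Y t)) t
     ((INR 2 * (x' * dcc s (X t)) * cc s (X t) ^ 1 + INR 2 * y' * Y t ^ 1) / (2 * r))).
  { apply (is_derive_sqrt (fun t => cc s (X t) ^ 2 + Y t ^ 2)); [|exact hr].
    apply (is_derive_plus (fun t => cc s (X t) ^ 2) (fun t => Y t ^ 2)).
    - apply (is_derive_pow (fun t => cc s (X t)) 2). exact dc.
    - apply (is_derive_pow Y 2). exact dY. }
  pose proof (is_derive_inv _ _ _ dr (Rgt_not_eq _ _ hp)) as di. fold r in di.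
  apply (is_derive_scal _ _ A) in di.
  pose proof (is_derive_plus _ _ _ _ _ dF di) as dH.
  match type of dH with is_derive _ _ ?l => replace l with 0 in dH end; [exact dH|].
  unfold plus; simpl. fold r. unfold y', x'.
  clearbody r. clear - hp. revert hp. generalize (cc s (X t)) (dcc s (X t)) (dFpot s (X t)) (Y t) r.
  clear. intros c d F y r hp. field. lra.
Qed.

Lemma ham_level (s A h x y : R) : 0 < A -> 0 < cc s x ^ 2 + y ^ 2 -> ham s A x y = h ->
  0 < h - Fpot s x /\ rho s x y = A / (h - Fpot s x).
Proof.
  intros hA hr hh. pose proof (rho_pos _ _ _ hr) as hp. unfold ham in hh.
  assert (E : h - Fpot s x = A / rho s x y) by lra. rewrite E.
  split; [apply Rdiv_lt_0_compat; lra | field; lra].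
Qed.

(** On the level, [(h - Fpot s x) / A] is [/ rho], so the two squared quantities are the cosine and
    the sine of the polar angle of [(cc s x, - y)]. *)
Lemma level_unit (s A h x y : R) : 0 < A -> 0 < cc s x ^ 2 + y ^ 2 -> ham s A x y = h ->
  kap s A h x ^ 2 + (- (y * (h - Fpot s x) / A)) ^ 2 = 1.
Proof.
  intros hA hr hh. destruct (ham_level _ _ _ _ _ hA hr hh) as [hq hrho].
  pose proof (rho_sqr s x y) as E. rewrite hrho in E.
  unfold kap. replace ((cc s x * (h - Fpot s x) / A) ^ 2 + (- (y * (h - Fpot s x) / A)) ^ 2)
    with ((cc s x ^ 2 + y ^ 2) * (h - Fpot s x) ^ 2 / A ^ 2) by (field; lra).
  rewrite <- E. field. lra.
Qed.

Lemma derive_continuity (f df : R -> R) : (forall t, is_derive f t (df t)) -> continuity f.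
Proof. intros h t. apply (continuity_pt_derive f t (df t)), h. Qed.

Lemma no_crossing (f : R -> R) (B : R) : continuity f -> (forall t, f t <> B) ->
  f 0 < B -> forall t, f t < B.
Proof.
  intros hc hB h0 t. destruct (Rlt_le_dec (f t) B) as [|ht]; [assumption|].
  destruct (IVT_gen f 0 t B hc) as [u [_ hu]]; [|destruct (hB u hu)].
  rewrite Rmin_left, Rmax_right by lra. lra.
Qed.

(** An orbit on the level cannot meet the line [x = B]: there [kap] is less than -1, whereas
    [level_unit] forces its square to be at most 1. *)
Lemma level_confined (s A k B h : R) (X Y : R -> R) : window s A B h ->
  red_sol s A k X Y -> X 0 < B -> ham s A (X 0) (Y 0) = h ->
  forall t, 0 < X t < B /\ ham s A (X t) (Y t) = h.
Proof.
  intros hw hsol h0 hh.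
  assert (hht : forall t, ham s A (X t) (Y t) = h).
  { intros t. rewrite <- hh. apply (ham_const s A k X Y hsol). }
  intros t. split; [split; [apply hsol|] | apply hht]. revert t.
  apply no_crossing;
    [exact (derive_continuity X _ (fun t => proj1 (proj2 (proj2 (hsol t))))) | | exact h0].
  intros t ht. pose proof (kap_window _ _ _ _ hw).
  pose proof (level_unit s A h (X t) (Y t) (proj1 (proj2 hw)) (proj1 (proj2 (hsol t))) (hht t)) as E.
  rewrite ht in E. pose proof (pow2_ge_0 (- (Y t * (h - Fpot s B) / A))).
  assert (1 < kap s A h B ^ 2) by (clear - H; nra). lra.
Qed.

(** The angular velocity: the value forced by differentiating [kap s A h (X t) = cos (phi t)], with
    [rho] replaced by [A / (h - Fpot s x)]. *)
Definition omega (s A k h x : R) : R := - dkap s A h x * k * (h - Fpot s x) ^ 2 / A.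

Lemma continuous_omega (s A k h x : R) : 0 < x -> continuous (omega s A k h) x.
Proof.
  intros hx.
  assert (e1 : ex_derive (cc s) x) by (exists (dcc s x); apply is_derive_cc).
  assert (e2 : ex_derive (dcc s) x) by (exists (cc s x); apply is_derive_dcc).
  assert (e3 : ex_derive (Fpot s) x) by (exists (dFpot s x); apply is_derive_Fpot; exact hx).
  assert (e4 : ex_derive (dFpot s) x) by (eexists; apply is_derive_dFpot; exact hx).
  apply (ex_derive_continuous (omega s A k h)). unfold omega, dkap. auto_derive.
  repeat split; [exact e2 | exact e3 | exact e1 | exact e4 | exact e3].
Qed.

Lemma omega_pos (s A k B h x : R) : window s A B h -> 0 < k -> 0 < x <= B -> 0 < omega s A k h x.
Proof.
  intros hw hk hx. pose proof (dkap_neg _ _ _ _ _ hw hx). pose proof (window_pot_lt _ _ _ _ _ hw hx).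
  destruct hw as [_ [hA _]]. unfold omega. apply Rdiv_lt_0_compat; [|exact hA].
  apply Rmult_lt_0_compat; [nra | apply pow_lt; lra].
Qed.

Lemma solution_angle (s A k B h : R) (X Y : R -> R) : window s A B h ->
  red_sol s A k X Y -> X 0 < B -> ham s A (X 0) (Y 0) = h ->
  exists phi, (forall t, is_derive phi t (omega s A k h (X t))) /\
    forall t, kap s A h (X t) = cos (phi t) /\ - (Y t * (h - Fpot s (X t)) / A) = sin (phi t).
Proof.
  intros hw hsol h0 hh. pose proof (level_confined _ _ _ _ _ _ _ hw hsol h0 hh) as hl.
  pose proof hw as [_ [hA _]].
  apply (angle_lift (fun t => kap s A h (X t)) (fun t => - (Y t * (h - Fpot s (X t)) / A))
     (fun t => omega s A k h (X t))).
  - intros t. destruct (hsol t) as [hX [hr [dX dY]]].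
    destruct (ham_level s A h (X t) (Y t) hA hr (proj2 (hl t))) as [hq hrho].
    pose proof (is_derive_comp (kap s A h) X t _ _ (is_derive_kap s A h (X t) hX) dX) as hd.
    match goal with |- is_derive _ _ ?l =>
      match type of hd with is_derive _ _ ?l' => replace l with l' end end; [exact hd|].
    unfold scal; simpl; unfold mult; simpl. rewrite hrho. unfold omega. field. lra.
  - intros t. destruct (hsol t) as [hX [hr [dX dY]]].
    destruct (ham_level s A h (X t) (Y t) hA hr (proj2 (hl t))) as [hq hrho].
    pose proof (is_derive_comp (Fpot s) X t _ _ (is_derive_Fpot s (X t) hX) dX) as hF.
    pose proof (is_derive_minus (fun _ => h) (fun t => Fpot s (X t)) t _ _
      (@is_derive_const R_AbsRing _ h t) hF) as hF'.
    pose proof (Derive.is_derive_mult Y _ t _ _ dY hF') as hm.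
    apply (is_derive_scal _ _ (- / A)) in hm.
    apply (is_derive_ext (fun t => - / A * (Y t * (h - Fpot s (X t))))).
    { intros u. change (- / A * (Y u * (h - Fpot s (X u))) = - (Y u * (h - Fpot s (X u)) / A)).
      unfold Rdiv; ring. }
    pose proof (rho_sqr s (X t) (Y t)) as Er. rewrite hrho in Er.
    match goal with |- is_derive _ _ ?l =>
      match type of hm with is_derive _ _ ?l' => replace l with l' end end; [exact hm|].
    unfold minus, plus, opp, zero, scal; simpl; unfold mult; simpl. rewrite hrho. unfold omega, dkap, kap.
    change (h + - Fpot s (X t)) with (h - Fpot s (X t)).
    clear - Er hq hA. revert Er hq hA.
    generalize (h - Fpot s (X t)) (cc s (X t)) (dcc s (X t)) (dFpot s (X t)) (Y t).
    clear. intros q c d F y Er hq hA.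
    assert (EA : A ^ 2 = (c ^ 2 + y ^ 2) * q ^ 2) by (rewrite <- Er; field; lra).
    (* The identity is true only on the level; the first term is written with a visible [A ^ 2] so
       that the level equation [EA] can be substituted there. *)
    transitivity (k * F * q * A ^ 2 / A ^ 3 - k * d * c * q ^ 4 / A ^ 3 - k * y ^ 2 * F * q ^ 3 / A ^ 3);
      [field; lra | rewrite EA; field; lra].
  - intros t. apply (continuous_comp X (omega s A k h)).
    + apply (ex_derive_continuous X). exact (ex_intro _ _ (proj1 (proj2 (proj2 (hsol t))))).
    + apply continuous_omega, hsol.
  - apply level_unit; [exact hA | apply hsol | exact hh].
Qed.

(** * Closed orbits *)

Lemma kap_inj (s A B h x y : R) : window s A B h -> 0 < x <= B -> 0 < y <= B ->
  kap s A h x = kap s A h y -> x = y.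
Proof.
  intros hw hx hy E. destruct (Rtotal_order x y) as [l | [l | l]]; [|exact l|].
  - pose proof (kap_decr s A B h x y hw ltac:(lra) l ltac:(lra)). lra.
  - pose proof (kap_decr s A B h y x hw ltac:(lra) l ltac:(lra)). lra.
Qed.

Definition on_level (s A B h x y : R) : Prop :=
  0 < x < B /\ 0 < cc s x ^ 2 + y ^ 2 /\ ham s A x y = h.

(** The converse of [level_unit]: every angle gives a point of the level. *)
Lemma on_level_angle (s A B h phi x : R) : window s A B h -> 0 < x < B ->
  kap s A h x = cos phi -> on_level s A B h x (- (A * sin phi / (h - Fpot s x))).
Proof.
  intros hw hx hk. pose proof (window_pot_lt _ _ _ _ x hw ltac:(lra)) as hq.
  destruct hw as [_ [hA _]].
  set (q := h - Fpot s x) in *.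
  assert (hc : cc s x = A * cos phi / q).
  { rewrite <- hk. unfold kap. fold q. field. unfold q; lra. }
  assert (Er : cc s x ^ 2 + (- (A * sin phi / q)) ^ 2 = (A / q) ^ 2).
  { rewrite hc. pose proof (sin2_cos2 phi) as E. unfold Rsqr in E.
    replace ((A * cos phi / q) ^ 2 + (- (A * sin phi / q)) ^ 2)
      with ((sin phi * sin phi + cos phi * cos phi) * (A / q) ^ 2) by (field; unfold q; lra).
    rewrite E. ring. }
  assert (0 < A / q) by (apply Rdiv_lt_0_compat; unfold q; lra).
  split; [exact hx | split].
  - rewrite Er. apply pow_lt. assumption.
  - unfold ham, rho. rewrite Er, sqrt_pow2 by lra.
    replace (A / (A / q)) with q by (field; unfold q; lra). unfold q; ring.
Qed.

(** The angle [p] parametrizes the level by [Th p = K (cos p)] and [Yp p]. Composing with the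
    solution [psi] of the phase equation gives a periodic solution covering the whole level. Any
    other solution on the level has an angle obeying the same phase equation, so it is a time
    translate. *)
Lemma closed_orbit (s A k B h : R) : window s A B h -> 0 < k ->
  exists (X Y : R -> R) (T : R), 0 < T /\ red_sol s A k X Y /\
    (forall t, X (t + T) = X t /\ Y (t + T) = Y t) /\
    (forall t, on_level s A B h (X t) (Y t)) /\
    (forall x y, on_level s A B h x y -> exists t, x = X t /\ y = Y t) /\
    (forall X1 Y1, red_sol s A k X1 Y1 -> X1 0 < B -> ham s A (X1 0) (Y1 0) = h ->
       exists tau, forall t, X1 t = X (t + tau) /\ Y1 t = Y (t + tau)).
Proof.
  intros hw hk. destruct (kap_inverse _ _ _ _ hw) as [K hK].
  pose proof (kap_window _ _ _ _ hw) as hB.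
  pose proof hw as [hs [hA _]].
  assert (hcos : forall p, kap s A h B < cos p) by (intros p; pose proof (COS_bound p); lra).
  pose (Th := fun p => K (cos p)).
  assert (hTh : forall p, 0 < Th p < B /\ kap s A h (Th p) = cos p) by (intros p; split; apply hK, hcos).
  assert (dTh : forall p, is_derive Th p (- sin p * / dkap s A h (Th p))).
  { intros p. apply (is_derive_comp K cos); [apply hK, hcos|]. auto_derive; auto; ring. }
  assert (hThp : forall p, Th (p + 2 * PI) = Th p).
  { intros p. unfold Th. rewrite cos_plus, cos_2PI, sin_2PI. f_equal. ring. }
  assert (hThi : forall p x, 0 < x < B -> kap s A h x = cos p -> x = Th p).
  { intros p x hx E. destruct (hTh p) as [h1 h2].
    apply (kap_inj s A B h); [exact hw | lra | lra | congruence]. }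
  pose (om := fun p => omega s A k h (Th p)).
  assert (com : forall p, continuous om p).
  { intros p. apply (continuous_comp Th (omega s A k h)).
    - apply (ex_derive_continuous Th). exact (ex_intro _ _ (dTh p)).
    - apply continuous_omega, hTh. }
  (* [Th] stays between its values at the angles 0 and [PI], as [kap] is decreasing and the cosine
     is extreme there. Compactness then bounds the speed from above, as [phase_clock] requires. *)
  assert (hM : exists M, forall x, Th 0 <= x <= Th PI -> omega s A k h x <= M).
  { destruct (continuity_ab_maj (omega s A k h) (Th 0) (Th PI)) as [Mx [hMx _]].
    - destruct (Rle_lt_dec (Th 0) (Th PI)) as [|l]; [assumption|].
      destruct (hTh 0) as [a1 a2]. destruct (hTh PI) as [b1 b2].
      pose proof (kap_decr s A B h _ _ hw (proj1 b1) l ltac:(lra)) as E.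
      rewrite a2, b2, cos_0, cos_PI in E. lra.
    - intros c hc. apply continuity_pt_filterlim, continuous_omega.
      destruct (hTh 0). lra.
    - exists (omega s A k h Mx). exact hMx. }
  destruct hM as [M hM].
  assert (hrange : forall p, Th 0 <= Th p <= Th PI).
  { intros p. pose proof (COS_bound p) as hb. destruct (hTh p) as [p1 p2].
    destruct (hTh 0) as [a1 a2]. destruct (hTh PI) as [b1 b2].
    rewrite cos_0 in a2. rewrite cos_PI in b2. split.
    - destruct (Rle_lt_dec (Th 0) (Th p)) as [|l]; [assumption|].
      pose proof (kap_decr s A B h _ _ hw (proj1 p1) l ltac:(lra)). lra.
    - destruct (Rle_lt_dec (Th p) (Th PI)) as [|l]; [assumption|].
      pose proof (kap_decr s A B h _ _ hw (proj1 b1) l ltac:(lra)). lra. }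
  destruct (phase_clock om M com) as [psi [T [hT [dpsi [hper [hsurj huniq]]]]]].
  { intros p. split; [|apply hM, hrange].
    apply (omega_pos s A k B h); [exact hw | exact hk |]. destruct (hTh p). lra. }
  { intros p. unfold om. rewrite hThp. reflexivity. }
  pose (Yp := fun p => - (A * sin p / (h - Fpot s (Th p)))).
  assert (hlev : forall p, on_level s A B h (Th p) (Yp p)).
  { intros p. apply on_level_angle; [exact hw | apply hTh | apply hTh]. }
  assert (hY : forall p y, - (y * (h - Fpot s (Th p)) / A) = sin p -> y = Yp p).
  { intros p y E. unfold Yp. rewrite <- E.
    pose proof (window_pot_lt s A B h (Th p) hw ltac:(destruct (hTh p); lra)). field. lra. }
  exists (fun t => Th (psi t)), (fun t => Yp (psi t)), T.
  split; [exact hT|]. split; [|split; [|split; [|split]]].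
  - intros t. set (p := psi t). destruct (hlev p) as [l1 [l2 l3]].
    destruct (ham_level _ _ _ _ _ hA l2 l3) as [hq hrho].
    pose proof (dkap_neg s A B h (Th p) hw ltac:(lra)) as hd.
    assert (dX : is_derive (fun t => Th (psi t)) t (om p * (- sin p * / dkap s A h (Th p)))).
    { apply (is_derive_comp Th psi); [apply dTh | apply dpsi]. }
    pose proof (proj2 (hTh p)) as hkp.
    assert (hc : cc s (Th p) = A * cos p / (h - Fpot s (Th p))).
    { rewrite <- hkp. unfold kap. field. lra. }
    split; [apply l1 | split; [exact l2 | split]].
    + match goal with |- is_derive _ _ ?l =>
        replace l with (om p * (- sin p * / dkap s A h (Th p))) end; [exact dX|].
      rewrite hrho. unfold om, omega, Yp.
      revert hq hd hA. clear.
      generalize (h - Fpot s (Th p)) (dkap s A h (Th p)) (sin p).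
      intros q d sn hq hd hA. field. lra.
    + assert (dF : is_derive (fun t => Fpot s (Th (psi t))) t
          (om p * (- sin p * / dkap s A h (Th p)) * dFpot s (Th p))).
      { apply (is_derive_comp (Fpot s) (fun t => Th (psi t))); [apply is_derive_Fpot; apply l1 | exact dX]. }
      assert (dsin : is_derive (fun t => - A * sin (psi t)) t (- A * (om p * cos p))).
      { apply is_derive_scal. apply (is_derive_comp sin psi); [|apply dpsi].
        apply is_derive_Reals, derivable_pt_lim_sin. }
      assert (dq : is_derive (fun t => h - Fpot s (Th (psi t))) t
          (0 - om p * (- sin p * / dkap s A h (Th p)) * dFpot s (Th p))).
      { apply (is_derive_minus (fun _ => h) (fun t => Fpot s (Th (psi t))));
          [apply (@is_derive_const R_AbsRing) | exact dF]. }
      pose proof (is_derive_div _ _ _ _ _ dsin dq (Rgt_not_eq _ _ hq)) as dY.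
      apply (is_derive_ext (fun t => - A * sin (psi t) / (h - Fpot s (Th (psi t))))).
      { intros u. change (- A * sin (psi u) / (h - Fpot s (Th (psi u))) =
          - (A * sin (psi u) / (h - Fpot s (Th (psi u))))). unfold Rdiv; ring. }
      match goal with |- is_derive _ _ ?l =>
        match type of dY with is_derive _ _ ?l' => replace l with l' end end; [exact dY|].
      cbv beta. fold p. rewrite hrho.
      pose proof (sin2_cos2 p) as E. unfold Rsqr in E.
      assert (hdk : dkap s A h (Th p) = (dcc s (Th p) * (h - Fpot s (Th p)) - cc s (Th p) * dFpot s (Th p)) / A)
        by reflexivity.
      unfold om, omega.
      revert hq hd hA hc E hdk. clear.
      generalize (h - Fpot s (Th p)) (dkap s A h (Th p)) (sin p) (cos p)
        (dcc s (Th p)) (cc s (Th p)) (dFpot s (Th p)).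
      intros q dk sn cs d c F hq hd hA hc E hdk.
      (* The square of the sine is isolated so that it can be traded for [1 - cs * cs]. *)
      transitivity (k * (q * cs * dk - (sn * sn) * F)).
      * field. lra.
      * rewrite hdk, hc. replace (sn * sn) with (1 - cs * cs) by lra. field. lra.
  - intros t. rewrite hper. unfold Yp. rewrite hThp. split; [reflexivity|].
    rewrite sin_plus, cos_2PI, sin_2PI, Rmult_1_r, Rmult_0_r, Rplus_0_r. reflexivity.
  - intros t. apply hlev.
  - intros x y [hx [hr hh]].
    pose proof (level_unit s A h x y hA hr hh) as E.
    (* Applied to constant functions with zero speed, the lifting lemma just produces a polar angle
       of a single point. *)
    destruct (angle_lift (fun _ => kap s A h x) (fun _ => - (y * (h - Fpot s x) / A)) (fun _ => 0))
      as [phi [_ hphi]]; try exact E.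
    + intros t. rewrite Rmult_0_r, Ropp_0. apply (@is_derive_const R_AbsRing).
    + intros t. rewrite Rmult_0_r. apply (@is_derive_const R_AbsRing).
    + intros t. apply continuous_const.
    + destruct (hphi 0) as [h1 h2]. destruct (hsurj (phi 0)) as [t ht]. exists t. rewrite ht.
      pose proof (hThi _ _ hx h1) as e. rewrite e in h2.
      split; [exact e | apply hY; exact h2].
  - intros X1 Y1 hsol h0 hh.
    pose proof (level_confined _ _ _ _ _ _ _ hw hsol h0 hh) as hl.
    destruct (solution_angle _ _ _ _ _ _ _ hw hsol h0 hh) as [phi [dphi hphi]].
    assert (e : forall t, X1 t = Th (phi t)).
    { intros t. apply hThi; [apply hl | apply hphi]. }
    destruct (huniq phi) as [tau htau].
    { intros t. unfold om. rewrite <- e. apply dphi. }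
    exists tau. intros t. rewrite <- htau. split; [apply e|].
    apply hY. rewrite <- e. apply hphi.
Qed.

(** * Leapfrogging orbits *)

Lemma dist2_coords (p q : R * R) :
  Rabs (fst q - fst p) <= dist2 p q /\ Rabs (snd q - snd p) <= dist2 p q.
Proof.
  pose proof (pow2_ge_0 (fst p - fst q)). pose proof (pow2_ge_0 (snd p - snd q)).
  unfold dist2. split; rewrite <- sqrt_Rsqr_abs; apply sqrt_le_1_alt; unfold Rsqr; lra.
Qed.

Lemma dist2_le (p q : R * R) : dist2 p q <= Rabs (fst p - fst q) + Rabs (snd p - snd q).
Proof.
  unfold dist2. pose proof (Rabs_pos (fst p - fst q)). pose proof (Rabs_pos (snd p - snd q)).
  rewrite <- (sqrt_pow2 (Rabs (fst p - fst q) + Rabs (snd p - snd q))) by lra.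
  apply sqrt_le_1_alt.
  rewrite <- (pow2_abs (fst p - fst q)), <- (pow2_abs (snd p - snd q)). nra.
Qed.

Lemma open2_and (U V : R * R -> Prop) : open2 U -> open2 V -> open2 (fun p => U p /\ V p).
Proof.
  intros hU hV p [pU pV]. destruct (hU p pU) as [a [ha ha']]. destruct (hV p pV) as [b [hb hb']].
  exists (Rmin a b). split; [apply Rmin_glb_lt; assumption|]. intros q hq.
  pose proof (Rmin_l a b). pose proof (Rmin_r a b).
  split; [apply ha' | apply hb']; lra.
Qed.

Lemma open2_or (U V : R * R -> Prop) : open2 U -> open2 V -> open2 (fun p => U p \/ V p).
Proof.
  intros hU hV p [pU | pV].
  - destruct (hU p pU) as [a [ha ha']]. exists a. split; auto.
  - destruct (hV p pV) as [a [ha ha']]. exists a. split; auto.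
Qed.

Lemma open2_fst_lt (c : R) : open2 (fun p => fst p < c).
Proof.
  intros p hp. exists (c - fst p). split; [lra|]. intros q hq.
  pose proof (dist2_coords p q) as [h _]. pose proof (Rle_abs (fst q - fst p)). lra.
Qed.

Lemma open2_fst_gt (c : R) : open2 (fun p => c < fst p).
Proof.
  intros p hp. exists (fst p - c). split; [lra|]. intros q hq.
  pose proof (dist2_coords p q) as [h _]. pose proof (Rle_abs (- (fst q - fst p))).
  rewrite Rabs_Ropp in *. lra.
Qed.

Lemma open2_superlevel (f : R -> R -> R) :
  (forall x y, 0 < x -> continuity_2d_pt f x y) ->
  open2 (fun p => 0 < fst p /\ 0 < f (fst p) (snd p)).
Proof.
  intros hf p [hp hfp].
  destruct (open2_fst_gt 0 p hp) as [a [ha ha']].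
  destruct (hf _ (snd p) hp (mkposreal _ hfp)) as [b hb].
  exists (Rmin a b). split; [apply Rmin_glb_lt; [exact ha | apply cond_pos]|]. intros q hq.
  pose proof (Rmin_l a b). pose proof (Rmin_r a b). pose proof (dist2_coords p q).
  split; [apply ha'; lra|].
  assert (h : Rabs (f (fst q) (snd q) - f (fst p) (snd p)) < f (fst p) (snd p)) by (apply hb; lra).
  apply Rabs_def2 in h. lra.
Qed.

(** The level equation [rho = A / (h - Fpot)] squared and cleared of denominators, in the original
    variable [W]. Unlike [ham], it is continuous also at [(theta_g, 0)]. *)
Definition level_defect (s A h dl x W : R) : R :=
  (cc s x ^ 2 + (s / dl) ^ 2 * (W * W)) * (h - Fpot s x) ^ 2 - A ^ 2.

Lemma level_defect_continuous (s A h dl x W : R) : 0 < x ->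
  continuity_2d_pt (level_defect s A h dl) x W.
Proof.
  intros hx. unfold level_defect.
  apply continuity_2d_pt_minus; [|apply continuity_2d_pt_const].
  apply continuity_2d_pt_mult; [apply continuity_2d_pt_plus|].
  - apply (continuity_1d_2d_pt_comp (fun x => cc s x ^ 2) (fun x _ => x)); [|apply continuity_2d_pt_id1].
    apply (continuity_pt_derive _ _ _ (is_derive_pow (cc s) 2 x _ (is_derive_cc s x))).
  - apply continuity_2d_pt_mult; [apply continuity_2d_pt_const|].
    apply continuity_2d_pt_mult; apply continuity_2d_pt_id2.
  - apply (continuity_1d_2d_pt_comp (fun x => (h - Fpot s x) ^ 2) (fun x _ => x)); [|apply continuity_2d_pt_id1].
    apply (continuity_pt_derive _ _ _ (is_derive_pow (fun x => h - Fpot s x) 2 x _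
      (is_derive_minus (fun _ => h) (Fpot s) x _ _ (@is_derive_const R_AbsRing _ h x) (is_derive_Fpot s x hx)))).
Qed.

Lemma on_level_defect (s A B h dl x W : R) : window s A B h -> 0 < dl -> 0 < x < B ->
  (on_level s A B h x (s * W / dl) <-> level_defect s A h dl x W = 0).
Proof.
  intros hw hdl hx. pose proof (window_pot_lt _ _ _ _ x hw ltac:(lra)) as hq.
  pose proof hw as [_ [hA _]]. unfold level_defect.
  replace ((s / dl) ^ 2 * (W * W)) with ((s * W / dl) ^ 2) by (field; lra).
  set (y := s * W / dl). split.
  - intros [_ [hr hh]]. destruct (ham_level _ _ _ _ _ hA hr hh) as [_ hrho].
    rewrite <- rho_sqr, hrho. field. lra.
  - intros E. assert (Er : cc s x ^ 2 + y ^ 2 = (A / (h - Fpot s x)) ^ 2).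
    { apply (Rmult_eq_reg_r ((h - Fpot s x) ^ 2)); [|apply pow_nonzero; lra].
      replace ((A / (h - Fpot s x)) ^ 2 * (h - Fpot s x) ^ 2) with (A ^ 2) by (field; lra). lra. }
    assert (hp : 0 < A / (h - Fpot s x)) by (apply Rdiv_lt_0_compat; lra).
    split; [exact hx | split].
    + rewrite Er. apply pow_lt, hp.
    + unfold ham, rho. rewrite Er, sqrt_pow2 by lra. field. lra.
Qed.

(** A connected set avoiding the level cannot leave the region [U] where the defect is negative and
    [x < B]: outside the level, the plane is covered by [U] and a disjoint open set [V]. The region
    [U] is bounded and contains [(theta_g, 0)]. *)
Lemma level_encloses (s A B h dl : R) (K : R * R -> Prop) : window s A B h -> 0 < dl ->
  (forall x W, K (x, W) <-> on_level s A B h x (s * W / dl)) ->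
  in_bounded_component_of_complement K (artanh (/ s), 0).
Proof.
  intros hw hdl hK. pose proof hw as [hs [hA [hB [hcB _]]]].
  set (D := level_defect s A h dl).
  assert (hc0 : cc s (artanh (/ s)) = 0) by (apply cc_artanh; exact hs).
  assert (h0 : 0 < artanh (/ s) < B).
  { split.
    - apply artanh_pos. split; [apply Rinv_0_lt_compat; lra|].
      rewrite <- Rinv_1. apply Rinv_lt_contravar; lra.
    - destruct (Rlt_le_dec (artanh (/ s)) B) as [|[l | l]]; [assumption| |].
      + pose proof (cc_decr s _ _ hs l). lra.
      + rewrite l in hcB. lra. }
  assert (hD0 : D (artanh (/ s)) 0 < 0).
  { unfold D, level_defect. rewrite hc0. pose proof (pow_lt A 2 hA). nra. }
  pose proof (kap_window _ _ _ _ hw) as hkB.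
  destruct (kap_onto_window s A B h 1 hw ltac:(lra)) as [x1 [hx1 k1]].
  destruct (kap_onto_window s A B h (-1) hw ltac:(lra)) as [x2 [hx2 k2]].
  (* A negative defect forces [kap ^ 2 < 1], which places [x] between the two points of the level on
     the axis, where [kap] is 1 and -1. This is what makes [U] and [V] disjoint. *)
  assert (hin : forall x W, 0 < x < B -> D x W < 0 -> x1 <= x <= x2).
  { intros x W hx hD.
    assert (hk : kap s A h x ^ 2 < 1).
    { apply (Rmult_lt_reg_r (A ^ 2)); [apply pow_lt; exact hA|].
      unfold kap. replace ((cc s x * (h - Fpot s x) / A) ^ 2 * A ^ 2)
        with (cc s x ^ 2 * (h - Fpot s x) ^ 2) by (field; lra).
      unfold D, level_defect in hD.
      assert (0 <= (s / dl) ^ 2 * (W * W) * (h - Fpot s x) ^ 2)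
        by (apply Rmult_le_pos; [apply Rmult_le_pos; [apply pow2_ge_0 | nra] | apply pow2_ge_0]).
      lra. }
    split.
    - destruct (Rle_lt_dec x1 x) as [|l]; [assumption|].
      pose proof (kap_decr s A B h _ _ hw (proj1 hx) l ltac:(lra)). nra.
    - destruct (Rle_lt_dec x x2) as [|l]; [assumption|].
      pose proof (kap_decr s A B h _ _ hw (proj1 hx2) l ltac:(lra)). nra. }
  split.
  { intros h1. apply hK in h1. apply on_level_defect in h1; try assumption. fold D in h1. lra. }
  pose (m := h - Fpot s B).
  assert (hm : 0 < m) by (pose proof (window_pot_lt _ _ _ _ B hw ltac:(lra)); unfold m; lra).
  (* In [U] one has [s / dl * Rabs W * (h - Fpot s x) <= A], and [h - Fpot s x] is at least its
     value [m] at [B]; hence [Rabs W <= w]. *)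
  pose (w := dl / s * (A / m)).
  assert (hw0 : 0 < w) by (unfold w; apply Rmult_lt_0_compat; apply Rdiv_lt_0_compat; lra).
  pose (U := fun p : R * R => fst p < B /\ (0 < fst p /\ 0 < - D (fst p) (snd p))).
  pose (V := fun p : R * R => fst p < x1 \/ (x2 < fst p \/ (0 < fst p /\ 0 < D (fst p) (snd p)))).
  assert (hbd : forall p, U p -> dist2 (artanh (/ s), 0) p <= B + w).
  { intros [x W] [hxB [hx hD]]. simpl in *.
    eapply Rle_trans; [apply dist2_le|]. simpl. apply Rplus_le_compat.
    - apply Rabs_le. lra.
    - rewrite Rminus_0_l, Rabs_Ropp.
      rewrite <- (Rabs_pos_eq w) by lra. apply Rsqr_le_abs_0.
      pose proof (Fpot_lt s x B hs hx hxB) as hF.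
      unfold D, level_defect in hD. unfold Rsqr.
      assert (e1 : (s / dl) ^ 2 * (W * W) * m ^ 2 <= A ^ 2).
      { assert (m ^ 2 <= (h - Fpot s x) ^ 2) by (unfold m in *; apply pow_incr; lra).
        assert (0 <= (s / dl) ^ 2 * (W * W)) by (apply Rmult_le_pos; [apply pow2_ge_0 | nra]).
        assert (0 <= cc s x ^ 2 * (h - Fpot s x) ^ 2) by (apply Rmult_le_pos; apply pow2_ge_0).
        nra. }
      replace (w * w) with ((dl / s) ^ 2 * / m ^ 2 * A ^ 2) by (unfold w; field; lra).
      replace (W * W) with ((dl / s) ^ 2 * / m ^ 2 * ((s / dl) ^ 2 * (W * W) * m ^ 2)) by (field; lra).
      apply Rmult_le_compat_l; [|exact e1].
      apply Rmult_le_pos; [apply pow2_ge_0|]. left. apply Rinv_0_lt_compat, pow_lt, hm. }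
  exists (B + w). intros S hS hSp hSK q hSq. apply hbd.
  destruct (classic (U q)) as [|hq]; [assumption|]. exfalso.
  assert (hcov : forall p, S p -> U p \/ V p).
  { intros [x W] hp. unfold U, V; simpl.
    destruct (Rlt_le_dec x x1) as [l1|l1]; [right; left; exact l1|].
    destruct (Rlt_le_dec x2 x) as [l2|l2]; [right; right; left; exact l2|].
    destruct (Rtotal_order (D x W) 0) as [l | [l | l]].
    - left. lra.
    - exfalso. apply (hSK _ hp), hK. apply on_level_defect; try assumption. lra.
    - right; right; right. lra. }
  apply (hS U V).
  - apply open2_and; [apply open2_fst_lt|]. apply (open2_superlevel (fun x y => - D x y)).
    intros x y hx. apply continuity_2d_pt_opp, level_defect_continuous, hx.
  - apply open2_or; [apply open2_fst_lt|]. apply open2_or; [apply open2_fst_gt|].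
    apply open2_superlevel. intros x y hx. apply level_defect_continuous, hx.
  - exact hcov.
  - intros [x W] _ [u1 [u2 u3]] hv. unfold V in hv. simpl in *.
    pose proof (hin x W ltac:(lra) ltac:(lra)). lra.
  - exists (artanh (/ s), 0). split; [exact hSp|]. unfold U; simpl. lra.
  - exists q. split; [exact hSq|]. destruct (hcov q hSq); [contradiction | assumption].
Qed.

(** * Passage between the original system and the rescaled one, with [g = s ^ 2] and [d = dl ^ 2] *)

Section Rescaling.
Variables (al s dl : R).
Hypothesis (hs : 1 < s) (hdl : 0 < dl).

Lemma theta_g_sqr : theta_g (s ^ 2) = artanh (/ s).
Proof. unfold theta_g. rewrite sqrt_pow2 by lra. reflexivity. Qed.

Lemma theta_g_pos : 0 < theta_g (s ^ 2).
Proof.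
  rewrite theta_g_sqr. apply artanh_pos. split; [apply Rinv_0_lt_compat; lra|].
  rewrite <- Rinv_1. apply Rinv_lt_contravar; lra.
Qed.

Lemma cc_theta_g : cc s (theta_g (s ^ 2)) = 0.
Proof. rewrite theta_g_sqr. apply cc_artanh, hs. Qed.

Lemma cc_neg_iff (x : R) : cc s x < 0 <-> theta_g (s ^ 2) < x.
Proof.
  pose proof cc_theta_g as E. split; intros h.
  - destruct (Rlt_le_dec (theta_g (s ^ 2)) x) as [|[l | l]]; [assumption | |].
    + pose proof (cc_decr s _ _ hs l). lra.
    + rewrite l in h. lra.
  - pose proof (cc_decr s _ _ hs h). lra.
Qed.

Lemma cc_pos_iff (x : R) : 0 < cc s x <-> x < theta_g (s ^ 2).
Proof.
  pose proof cc_theta_g as E. split; intros h.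
  - destruct (Rlt_le_dec x (theta_g (s ^ 2))) as [|[l | l]]; [assumption | |].
    + pose proof (cc_decr s _ _ hs l). lra.
    + rewrite <- l in h. lra.
  - pose proof (cc_decr s _ _ hs h). lra.
Qed.

(** The point removed from the half-plane is exactly the zero of [rho]. *)
Lemma Omega_iff (x W : R) :
  Omega (s ^ 2) x W <-> 0 < x /\ 0 < cc s x ^ 2 + (s * W / dl) ^ 2.
Proof.
  assert (Ey : W <> 0 -> 0 < (s * W / dl) ^ 2).
  { intros hW. apply pow2_gt_0. unfold Rdiv. repeat apply Rmult_integral_contrapositive_currified;
      try lra. apply Rinv_neq_0_compat; lra. }
  pose proof (pow2_ge_0 (s * W / dl)). pose proof (pow2_ge_0 (cc s x)).
  unfold Omega. split.
  - intros [hx hn]. split; [exact hx|].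
    destruct (Req_dec W 0) as [e | e]; [|specialize (Ey e); lra].
    assert (cc s x <> 0).
    { intros hc. apply hn. split; [|exact e].
      destruct (Rtotal_order x (theta_g (s ^ 2))) as [l | [l | l]]; [|exact l|].
      - apply cc_pos_iff in l. lra.
      - apply cc_neg_iff in l. lra. }
    pose proof (pow2_gt_0 _ H1). lra.
  - intros [hx hr]. split; [exact hx|]. intros [-> ->]. rewrite cc_theta_g in hr.
    unfold Rdiv in hr. rewrite Rmult_0_r, Rmult_0_l in hr. lra.
Qed.

Lemma Eg_rho (x W : R) : Eg (dl ^ 2) (s ^ 2) x W = (dl / s * rho s x (s * W / dl)) ^ 2.
Proof.
  rewrite Rpow_mult_distr, rho_sqr. unfold Eg, cc. rewrite sqrt_pow2 by lra. field. lra.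
Qed.

Lemma sqrt_Eg (x W : R) : sqrt (Eg (dl ^ 2) (s ^ 2) x W) = dl / s * rho s x (s * W / dl).
Proof.
  rewrite Eg_rho. apply sqrt_pow2. apply Rmult_le_pos; [|apply sqrt_pos].
  left; apply Rdiv_lt_0_compat; lra.
Qed.

Lemma Gc_ham (x W : R) : Omega (s ^ 2) x W ->
  Gc al (dl ^ 2) (s ^ 2) x W = / dl * ham s (al * s ^ 2) x (s * W / dl).
Proof.
  intros hO. apply Omega_iff in hO. destruct hO as [_ hr]. pose proof (rho_pos _ _ _ hr).
  unfold Gc, ham, Fpot, pow32. rewrite sqrt_Eg, !sqrt_pow2 by lra. field. lra.
Qed.

Lemma G1_red (x W : R) : Omega (s ^ 2) x W -> G1 al (dl ^ 2) (s ^ 2) x W =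
  - (s / dl ^ 2 * (al * s ^ 2) * (s * W / dl) / rho s x (s * W / dl) ^ 3).
Proof.
  intros hO. apply Omega_iff in hO. destruct hO as [_ hr]. pose proof (rho_pos _ _ _ hr).
  unfold G1, pow32. rewrite sqrt_Eg, Eg_rho, !sqrt_pow2 by lra.
  set (r := rho s x (s * W / dl)) in *. field. lra.
Qed.

Lemma G2_red (x W : R) : Omega (s ^ 2) x W -> s / dl * G2 al (dl ^ 2) (s ^ 2) x W =
  s / dl ^ 2 * (- dFpot s x + (al * s ^ 2) * dcc s x * cc s x / rho s x (s * W / dl) ^ 3).
Proof.
  intros hO. apply Omega_iff in hO. destruct hO as [hx hr]. pose proof (rho_pos _ _ _ hr).
  unfold G2, pow32. rewrite sqrt_Eg, Eg_rho, !sqrt_pow2 by lra.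
  unfold dFpot, dcc, cc. set (r := rho s x (s * W / dl)) in *.
  pose proof (cosh_pos x). pose proof (sinh_pos x hx). field. lra.
Qed.

Lemma is_solution_red (th W : R -> R) : is_solution al (dl ^ 2) (s ^ 2) th W ->
  red_sol s (al * s ^ 2) (s / dl ^ 2) th (fun t => s * W t / dl).
Proof.
  intros hsol t. destruct (hsol t) as [hO [d1 d2]].
  pose proof (proj1 (Omega_iff _ _) hO) as [hx hr].
  split; [exact hx | split; [exact hr | split]].
  - rewrite <- G1_red by exact hO. apply is_derive_Reals, d1.
  - rewrite <- G2_red by exact hO.
    apply (is_derive_ext (fun t => s / dl * W t)).
    { intros u. change (s / dl * W u = s * W u / dl). field. lra. }
    apply is_derive_scal, is_derive_Reals, d2.
Qed.

Lemma red_is_solution (X Y : R -> R) : red_sol s (al * s ^ 2) (s / dl ^ 2) X Y ->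
  is_solution al (dl ^ 2) (s ^ 2) X (fun t => dl * Y t / s).
Proof.
  intros hsol t. destruct (hsol t) as [hx [hr [d1 d2]]].
  assert (E : s * (dl * Y t / s) / dl = Y t) by (field; lra).
  assert (hO : Omega (s ^ 2) (X t) (dl * Y t / s)).
  { apply Omega_iff. rewrite E. split; assumption. }
  split; [exact hO | split].
  - rewrite G1_red by exact hO. rewrite E. apply is_derive_Reals, d1.
  - pose proof (G2_red _ _ hO) as E2. rewrite E in E2. rewrite <- E2 in d2.
    apply is_derive_Reals.
    apply (is_derive_scal _ _ (dl / s)) in d2.
    replace (dl / s * (s / dl * G2 al (dl ^ 2) (s ^ 2) (X t) (dl * Y t / s)))
      with (G2 al (dl ^ 2) (s ^ 2) (X t) (dl * Y t / s)) in d2 by (field; lra).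
    apply (is_derive_ext (fun t => dl / s * Y t)); [|exact d2].
    intros u. change (dl / s * Y u = dl * Y u / s). field. lra.
Qed.

(** The level inside the window is a single closed orbit, so every solution with these data is a
    time translate of the one built on it, and its orbit is the whole level, which encloses
    [(theta_g, 0)]. *)
Lemma leap_of_window (B h th0 W0 : R) : window s (al * s ^ 2) B h ->
  Omega (s ^ 2) th0 W0 -> th0 < B -> ham s (al * s ^ 2) th0 (s * W0 / dl) = h ->
  leap_from al (dl ^ 2) (s ^ 2) th0 W0.
Proof.
  intros hw hO hB hh.
  destruct (closed_orbit s _ (s / dl ^ 2) B h hw) as [X [Y [T [hT [hsol [hper [hlev [hsurj huniq]]]]]]]].
  { apply Rdiv_lt_0_compat; [lra | apply pow_lt, hdl]. }
  pose proof (proj1 (Omega_iff _ _) hO) as [hx0 hr0].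
  split.
  - destruct (hsurj th0 (s * W0 / dl)) as [t0 [e1 e2]].
    { split; [lra | split; assumption]. }
    exists (fun t => X (t + t0)), (fun t => dl * Y (t + t0) / s).
    split; [|rewrite Rplus_0_l, <- e1, <- e2; split; [reflexivity | field; lra]].
    apply (red_is_solution (fun t => X (t + t0)) (fun t => Y (t + t0))).
    intros t. destruct (hsol (t + t0)) as [a [b [c e]]].
    assert (shift : forall (f : R -> R) (l : R), is_derive f (t + t0) l -> is_derive (fun t => f (t + t0)) t l).
    { intros f l hf. rewrite <- (Rmult_1_l l).
      apply (is_derive_comp f (fun t => t + t0)); [exact hf | auto_derive; auto]. }
    split; [exact a | split; [exact b | split; apply shift; assumption]].
  - intros th W hs1 i1 i2.
    destruct (huniq th (fun t => s * W t / dl)) as [tau htau].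
    { apply is_solution_red, hs1. }
    { rewrite i1; exact hB. }
    { rewrite i1, i2; exact hh. }
    assert (hW : forall t, W t = dl * Y (t + tau) / s).
    { intros t. rewrite <- (proj2 (htau t)). field. lra. }
    pose proof (kap_window _ _ _ _ hw) as hkB.
    split; [|split].
    (* The angles 0 and [PI] give points of the orbit with different first coordinates, since [kap]
       is 1 at one and -1 at the other. *)
    + destruct (kap_onto_window s _ B h 1 hw ltac:(lra)) as [x1 [hx1 k1]].
      destruct (kap_onto_window s _ B h (-1) hw ltac:(lra)) as [x2 [hx2 k2]].
      destruct (hsurj _ _ (on_level_angle s _ B h 0 x1 hw hx1 ltac:(rewrite cos_0; exact k1))) as [t1 [e1 _]].
      destruct (hsurj _ _ (on_level_angle s _ B h PI x2 hw hx2 ltac:(rewrite cos_PI; exact k2))) as [t2 [e2 _]].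
      exists (t1 - tau), (t2 - tau). intros E. apply (f_equal fst) in E. simpl in E.
      rewrite (proj1 (htau _)), (proj1 (htau (t2 - tau))) in E.
      replace (t1 - tau + tau) with t1 in E by ring. replace (t2 - tau + tau) with t2 in E by ring.
      rewrite <- e1, <- e2 in E. rewrite E in k1. lra.
    + exists T. split; [exact hT|]. intros t.
      rewrite (proj1 (htau (t + T))), (proj1 (htau t)), !hW.
      replace (t + T + tau) with (t + tau + T) by ring.
      rewrite (proj1 (hper _)), (proj2 (hper _)). split; reflexivity.
    + rewrite theta_g_sqr. apply (level_encloses s (al * s ^ 2) B h dl); [exact hw | exact hdl |].
      intros x w. split.
      * intros [t E]. injection E as -> ->. rewrite hW.
        replace (s * (dl * Y (t + tau) / s) / dl) with (Y (t + tau)) by (field; lra).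
        rewrite (proj1 (htau t)). apply hlev.
      * intros hl. destruct (hsurj _ _ hl) as [t [e1 e2]]. exists (t - tau).
        rewrite (proj1 (htau _)), hW. replace (t - tau + tau) with t by ring.
        rewrite <- e1, <- e2. f_equal. field. lra.
Qed.
End Rescaling.

(** * The Hamiltonian on the axis *)

Section Axis.
Variables (s A : R).
Hypothesis (hs : 1 < s) (hA : 0 < A).

Lemma rho_axis_pos (x : R) : 0 < cc s x -> rho s x 0 = cc s x.
Proof.
  intros h. unfold rho. replace (cc s x ^ 2 + 0 ^ 2) with (cc s x ^ 2) by ring. apply sqrt_pow2; lra.
Qed.

Lemma rho_axis_neg (x : R) : cc s x < 0 -> rho s x 0 = - cc s x.
Proof.
  intros h. unfold rho. replace (cc s x ^ 2 + 0 ^ 2) with ((- cc s x) ^ 2) by ring. apply sqrt_pow2; lra.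
Qed.

Lemma ham_le_axis (x y : R) : cc s x <> 0 -> ham s A x y <= ham s A x 0.
Proof.
  intros hc. unfold ham. pose proof (pow2_gt_0 _ hc). pose proof (pow2_ge_0 y).
  apply Rplus_le_compat_l. apply Rmult_le_compat_l; [lra|].
  apply Rinv_le_contravar; [apply rho_pos; lra|].
  apply sqrt_le_1_alt. lra.
Qed.

Lemma axis_incr_left (x y : R) : 0 < x -> x < y -> y < theta_g (s ^ 2) ->
  ham s A x 0 < ham s A y 0.
Proof.
  intros hx hxy hy. apply (cc_pos_iff _ hs) in hy.
  pose proof (cc_decr s x y hs hxy). pose proof (Fpot_lt s x y hs hx hxy).
  unfold ham. rewrite !rho_axis_pos by lra.
  apply Rplus_lt_compat; [assumption|].
  apply Rmult_lt_compat_l; [exact hA|]. apply Rinv_lt_contravar; nra.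
Qed.

Lemma axis_derive_sign (x : R) : 0 < x -> cc s x < 0 ->
  dFpot s x - A * - dcc s x / cc s x ^ 2 = (qfun s (tanh x) - A) * (- dcc s x / cc s x ^ 2).
Proof.
  intros hx hc. pose proof (qfun_tanh s x hs hx) as E.
  assert (Ed : dFpot s x = qfun s (tanh x) * - dcc s x / cc s x ^ 2).
  { rewrite <- E. field. lra. }
  rewrite Ed. field. lra.
Qed.

Lemma dcc_ratio_pos (x : R) : cc s x < 0 -> 0 < - dcc s x / cc s x ^ 2.
Proof.
  intros hc. pose proof (dcc_neg s x hs). apply Rdiv_lt_0_compat; [lra | apply pow2_gt_0; lra].
Qed.

Lemma is_derive_axis (x : R) : 0 < x -> cc s x < 0 ->
  is_derive (fun x => Fpot s x + A * / - cc s x) x ((qfun s (tanh x) - A) * (- dcc s x / cc s x ^ 2)).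
Proof.
  intros hx hc. rewrite <- axis_derive_sign by assumption.
  apply (is_derive_plus (Fpot s) (fun x => A * / - cc s x)); [apply is_derive_Fpot; exact hx|].
  replace (- (A * - dcc s x / cc s x ^ 2)) with (A * (- - dcc s x / (- cc s x) ^ 2)) by (field; lra).
  apply is_derive_scal. apply (is_derive_inv (fun x => - cc s x)); [|lra].
  apply (is_derive_opp (cc s)), is_derive_cc.
Qed.

Lemma axis_decr_right (x y : R) : theta_g (s ^ 2) < x -> x < y -> qfun s (tanh y) <= A ->
  ham s A y 0 < ham s A x 0.
Proof.
  intros hx hxy hq. pose proof (theta_g_pos s hs) as h0.
  assert (hc : forall z, x <= z -> cc s z < 0) by (intros z hz; apply (cc_neg_iff _ hs); lra).
  unfold ham. rewrite !rho_axis_neg by (apply hc; lra).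
  apply Ropp_lt_cancel.
  apply (MVT_strict_incr (fun x => - (Fpot s x + A * / - cc s x))
    (fun x => - ((qfun s (tanh x) - A) * (- dcc s x / cc s x ^ 2)))); [exact hxy | |].
  - intros z hz. apply (is_derive_opp (fun x => Fpot s x + A * / - cc s x)).
    apply is_derive_axis; [lra | apply hc; lra].
  - intros z hz. pose proof (dcc_ratio_pos z (hc z ltac:(lra))).
    assert (qfun s (tanh z) < qfun s (tanh y)).
    { apply qfun_incr; [exact hs | apply tanh_gt_inv; [exact hs | apply hc; lra] |
        apply tanh_incr; lra | left; apply tanh_lt_1]. }
    nra.
Qed.

Lemma axis_incr_right (x y : R) : theta_g (s ^ 2) < x -> x < y -> A <= qfun s (tanh x) ->
  ham s A x 0 < ham s A y 0.
Proof.
  intros hx hxy hq. pose proof (theta_g_pos s hs) as h0.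
  assert (hc : forall z, x <= z -> cc s z < 0) by (intros z hz; apply (cc_neg_iff _ hs); lra).
  unfold ham. rewrite !rho_axis_neg by (apply hc; lra).
  apply (MVT_strict_incr (fun x => Fpot s x + A * / - cc s x)
    (fun x => (qfun s (tanh x) - A) * (- dcc s x / cc s x ^ 2))); [exact hxy | |].
  - intros z hz. apply is_derive_axis; [lra | apply hc; lra].
  - intros z hz. pose proof (dcc_ratio_pos z (hc z ltac:(lra))).
    assert (qfun s (tanh x) < qfun s (tanh z)).
    { apply qfun_incr; [exact hs | apply tanh_gt_inv; [exact hs | apply hc; lra] |
        apply tanh_incr; lra | left; apply tanh_lt_1]. }
    nra.
Qed.

Lemma tanh_artanh (u : R) : 0 < u < 1 -> tanh (artanh u) = u.
Proof.
  intros hu. assert (h : 1 < / u) by (rewrite <- Rinv_1; apply Rinv_lt_contravar; lra).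
  pose proof (cc_artanh (/ u) h) as E. rewrite Rinv_inv in E. unfold cc in E.
  pose proof (cosh_pos (artanh u)). unfold tanh.
  assert (sinh (artanh u) = u * cosh (artanh u)).
  { replace (cosh (artanh u)) with (/ u * sinh (artanh u)) by lra. field. lra. }
  rewrite H0. field. lra.
Qed.

Lemma qfun_1 : qfun s 1 = (s ^ 3 + 1) * (s - 1).
Proof. unfold qfun. field. lra. Qed.

(** The function [qfun s] vanishes at [/ s], the value of [tanh] at [theta_g], so the intermediate
    value theorem applies between [/ s] and 1. *)
Lemma qfun_root : A < qfun s 1 -> exists x, theta_g (s ^ 2) < x /\ qfun s (tanh x) = A.
Proof.
  intros hq.
  assert (hi : 0 < / s < 1).
  { split; [apply Rinv_0_lt_compat; lra|]. rewrite <- Rinv_1. apply Rinv_lt_contravar; lra. }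
  assert (e0 : qfun s (/ s) = 0).
  { unfold qfun. rewrite Rinv_inv. replace (s - s) with 0 by ring. ring. }
  destruct (IVT_interv (fun u => qfun s u - A) (/ s) 1) as [u [hu hu']]; try lra.
  { intros u hu.
    assert (ex_derive (fun u => qfun s u - A) u) as [l hl].
    { unfold qfun. auto_derive. repeat split; lra. }
    exact (continuity_pt_derive _ _ _ hl). }
  assert (u <> / s) by (intros ->; lra).
  assert (u <> 1) by (intros ->; lra).
  exists (artanh u). rewrite tanh_artanh by lra. split; [|lra].
  destruct (Rlt_le_dec (theta_g (s ^ 2)) (artanh u)) as [|l]; [assumption|]. exfalso.
  assert (tanh (artanh u) <= / s).
  { rewrite <- (tanh_artanh (/ s)), <- theta_g_sqr by lra.
    destruct l as [l | ->]; [left; apply tanh_incr, l | lra]. }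
  rewrite tanh_artanh in H1 by lra. lra.
Qed.

Lemma qfun_tanh_lt_1 (x : R) : theta_g (s ^ 2) < x -> qfun s (tanh x) < qfun s 1.
Proof.
  intros hx. apply qfun_incr; [exact hs | | apply tanh_lt_1 | lra].
  apply tanh_gt_inv; [exact hs | apply (cc_neg_iff _ hs); exact hx].
Qed.

Lemma qfun_tanh_incr (x y : R) : theta_g (s ^ 2) < x -> x < y ->
  qfun s (tanh x) < qfun s (tanh y).
Proof.
  intros hx hxy. apply qfun_incr; [exact hs | | apply tanh_incr; exact hxy | left; apply tanh_lt_1].
  apply tanh_gt_inv; [exact hs | apply (cc_neg_iff _ hs); exact hx].
Qed.

Lemma qfun_tanh_inj (x y : R) : theta_g (s ^ 2) < x -> theta_g (s ^ 2) < y ->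
  qfun s (tanh x) = qfun s (tanh y) -> x = y.
Proof.
  intros hx hy E. destruct (Rtotal_order x y) as [l | [l | l]]; [|exact l|].
  - pose proof (qfun_tanh_incr _ _ hx l). lra.
  - pose proof (qfun_tanh_incr _ _ hy l). lra.
Qed.

(** To the left of [theta_g], where [rho = cc] on the axis, [ham = m] amounts to [kap s A m x = 1];
    at [theta_g] itself [kap] is 0. *)
Lemma axis_onto_left (m : R) : exists x, 0 < x < theta_g (s ^ 2) /\ ham s A x 0 = m.
Proof.
  pose proof (cc_theta_g s hs) as E.
  destruct (kap_onto s A (theta_g (s ^ 2)) m 1) as [x [hx hk]]; try assumption; try lra.
  - apply theta_g_pos, hs.
  - unfold kap. rewrite E. unfold Rdiv. rewrite !Rmult_0_l. lra.
  - exists x. split; [exact hx|].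
    assert (hc : 0 < cc s x) by (apply (cc_pos_iff _ hs); lra).
    unfold ham. rewrite rho_axis_pos by exact hc.
    unfold kap in hk. assert (cc s x * (m - Fpot s x) = A).
    { transitivity (cc s x * (m - Fpot s x) / A * A); [field; lra | rewrite hk; ring]. }
    rewrite <- H. field. lra.
Qed.

(** At infinity [tanh] tends to 1 from below, where the arctangent is [PI / 4] and the logarithm is
    0. *)
Lemma Fpot_lt_limit (x : R) : 0 < x -> Fpot s x < s ^ 3 * PI / 2.
Proof.
  intros hx. unfold Fpot. pose proof (tanh_pos (x / 2) ltac:(lra)). pose proof (tanh_lt_1 (x / 2)).
  assert (ln (tanh (x / 2)) < 0) by (rewrite <- ln_1; apply ln_increasing; lra).
  pose proof (atan_increasing _ _ H0) as ha. rewrite atan_1 in ha.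
  assert (0 < s ^ 3) by (apply pow_lt; lra). nra.
Qed.

Lemma Fpot_near_limit (e M : R) : 0 < e -> exists x, M < x /\ 0 < x /\ s ^ 3 * PI / 2 - e < Fpot s x.
Proof.
  intros he.
  assert (hc : continuity_pt (fun u => 2 * s ^ 3 * atan u + ln u) 1).
  { apply continuity_pt_plus; apply derivable_continuous_pt.
    - apply derivable_pt_scal, derivable_pt_atan.
    - exists (/ 1). apply derivable_pt_lim_ln. lra. }
  destruct (proj1 (continuity_pt_locally _ _) hc (mkposreal e he)) as [d hd]. simpl in hd.
  (* Any [u] strictly between [v] and 1 is positive, within [d] of 1, and satisfies
     [2 * artanh u > M]. *)
  set (v := Rmax (1 - d) (Rmax (/ 2) (tanh (M / 2)))).
  assert (hv : v < 1).
  { pose proof (cond_pos d). pose proof (tanh_lt_1 (M / 2)). unfold v. repeat apply Rmax_lub_lt; lra. }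
  assert (v1 : 1 - d <= v) by apply Rmax_l.
  assert (v2 : / 2 <= v) by (eapply Rle_trans; [apply Rmax_l | apply Rmax_r]).
  assert (v3 : tanh (M / 2) <= v) by (eapply Rle_trans; [apply Rmax_r | apply Rmax_r]).
  set (u := (1 + v) / 2).
  assert (hu : v < u < 1) by (unfold u; lra).
  exists (2 * artanh u). pose proof (artanh_pos u ltac:(lra)).
  assert (Eh : 2 * artanh u / 2 = artanh u) by field.
  split; [|split; [lra|]].
  - destruct (Rlt_le_dec M (2 * artanh u)) as [|l]; [assumption|]. exfalso.
    assert (tanh (artanh u) <= tanh (M / 2)).
    { destruct (Rle_lt_or_eq_dec (artanh u) (M / 2)) as [k | ->]; [lra | left; apply tanh_incr, k | lra]. }
    rewrite tanh_artanh in H0 by lra. lra.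
  - unfold Fpot. rewrite Eh, tanh_artanh by lra.
    assert (hb : ball 1 d u).
    { change (Rabs (u - 1) < d). apply Rabs_def1; lra. }
    specialize (hd u hb). rewrite atan_1, ln_1 in hd. apply Rabs_def2 in hd. lra.
Qed.

(** Under this condition the profile decreases on the whole axis to the right of [theta_g]; far out
    it exceeds [Fpot], whose limit is the claimed bound. *)
Lemma axis_gt_limit (x : R) : qfun s 1 <= A -> theta_g (s ^ 2) < x ->
  s ^ 3 * PI / 2 < ham s A x 0.
Proof.
  intros hq hx. destruct (Rlt_le_dec (s ^ 3 * PI / 2) (ham s A x 0)) as [|l]; [assumption|]. exfalso.
  assert (hdec : forall y z, theta_g (s ^ 2) < y -> y < z -> ham s A z 0 < ham s A y 0).
  { intros y z hy hyz. apply axis_decr_right; [exact hy | exact hyz|].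
    pose proof (qfun_tanh_lt_1 z ltac:(lra)). lra. }
  (* Moving to [x + 1] gives a strict gap below the limit; far away [Fpot] alone rises above
     [ham s A (x + 1) 0], contradicting the decrease. *)
  pose proof (hdec x (x + 1) hx ltac:(lra)) as h1.
  destruct (Fpot_near_limit (s ^ 3 * PI / 2 - ham s A (x + 1) 0) (x + 1)) as [z [hz [hz0 hz']]]; [lra|].
  pose proof (hdec (x + 1) z ltac:(lra) hz) as h2.
  assert (hc : cc s z < 0) by (apply (cc_neg_iff _ hs); lra).
  assert (0 < A / rho s z 0).
  { rewrite rho_axis_neg by exact hc. apply Rdiv_lt_0_compat; lra. }
  unfold ham in h2 at 1. lra.
Qed.

Lemma window_of_axis (B h : R) : theta_g (s ^ 2) < B -> qfun s (tanh B) <= A ->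
  ham s A B 0 < h -> window s A B h.
Proof.
  intros hB hq hh. pose proof (theta_g_pos s hs).
  assert (hc : cc s B < 0) by (apply (cc_neg_iff _ hs); exact hB).
  unfold ham in hh. rewrite rho_axis_neg in hh by exact hc.
  pose proof (dcc_neg s B hs).
  repeat split; try assumption; try lra.
  rewrite qfun_tanh by (try assumption; lra). apply Rmult_le_compat_r; lra.
Qed.

Lemma cc_unbounded (c M : R) : exists x, M < x /\ cc s x < c.
Proof.
  (* Chosen so that [(s - 1) * x >= 2 * Rabs c + s + 1]; with [exp x >= 1 + x] and [exp (- x) <= 1]
     this gives [cc s x < c]. *)
  pose (x := Rabs M + (2 * Rabs c + s + 1) / (s - 1) + 1).
  assert (hb : 0 <= (2 * Rabs c + s + 1) / (s - 1)).
  { pose proof (Rabs_pos c). left. apply Rdiv_lt_0_compat; lra. }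
  pose proof (Rabs_pos M). pose proof (Rle_abs M).
  exists x. split; [unfold x; lra|].
  assert (hx : 0 <= x) by (unfold x; lra).
  pose proof (exp_ineq1_le x) as e1.
  assert (e2 : exp (- x) <= 1) by (rewrite <- exp_0; destruct hx as [hx | <-];
    [left; apply exp_increasing; lra | rewrite Ropp_0; lra]).
  assert (e3 : (s - 1) * x >= 2 * Rabs c + s + 1).
  { unfold x. replace (2 * Rabs c + s + 1) with ((s - 1) * ((2 * Rabs c + s + 1) / (s - 1))) at 2 by (field; lra).
    nra. }
  pose proof (Rle_abs (- c)). rewrite Rabs_Ropp in *.
  unfold cc, cosh, sinh. nra.
Qed.
End Axis.

(** * Turning points of periodic solutions *)

Lemma periodic_nat (f : R -> R) (T : R) : (forall t, f (t + T) = f t) ->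
  forall (n : nat) t, f (t + INR n * T) = f t.
Proof.
  intros hf n. induction n as [|n IH]; intros t.
  - simpl. rewrite Rmult_0_l, Rplus_0_r. reflexivity.
  - rewrite S_INR. replace (t + (INR n + 1) * T) with (t + INR n * T + T) by ring.
    rewrite hf. apply IH.
Qed.

Lemma periodic_shift_ge (T t c : R) : 0 < T -> exists n : nat, c <= t + INR n * T.
Proof.
  intros hT. destruct (INR_unbounded ((c - t) / T)) as [n hn]. exists n.
  apply Rgt_lt, (Rmult_lt_compat_r T) in hn; [|exact hT].
  unfold Rdiv in hn. rewrite Rmult_assoc, Rinv_l, Rmult_1_r in hn; lra.
Qed.

Lemma periodic_window (f : R -> R) (T t : R) : 0 < T -> (forall t, f (t + T) = f t) ->
  exists u, 0 <= u <= T /\ f u = f t.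
Proof.
  intros hT hf.
  destruct (euclidian_division t T ltac:(lra)) as [n [u [e hu]]].
  rewrite (Rabs_pos_eq T) in hu by lra.
  exists u. split; [lra|]. rewrite e.
  destruct n as [|p|p].
  - rewrite Rmult_0_l, Rplus_0_l. reflexivity.
  - rewrite <- (positive_nat_Z p), <- INR_IZR_INZ, Rplus_comm. symmetry. apply periodic_nat, hf.
  - rewrite <- Pos2Z.opp_pos, opp_IZR, <- (positive_nat_Z p), <- INR_IZR_INZ.
    rewrite <- (periodic_nat f T hf (Pos.to_nat p) (- INR (Pos.to_nat p) * T + u)). f_equal. ring.
Qed.

Lemma derive_zero_at_max (f : R -> R) (c l : R) :
  is_derive f c l -> (forall x, f x <= f c) -> l = 0.
Proof.
  intros hd hm. apply is_derive_Reals in hd.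
  pose proof (deriv_maximum f (c - 1) (c + 1) c (exist _ l hd)) as E.
  simpl in E. apply E; try lra. intros; apply hm.
Qed.

(** Values and derivatives agree at [c], so one bound holds for increments of either sign. This
    serves to stop a solution at an equilibrium. *)
Lemma glue_derivable (f g : R -> R) (c : R) (df dg : R -> R) :
  (forall t, derivable_pt_lim f t (df t)) -> (forall t, derivable_pt_lim g t (dg t)) ->
  f c = g c -> df c = dg c ->
  forall t, derivable_pt_lim (fun t => if Rlt_dec t c then f t else g t) t
    (if Rlt_dec t c then df t else dg t).
Proof.
  intros hf hg e de t. destruct (Rtotal_order t c) as [l | [-> | l]].
  - destruct (Rlt_dec t c) as [_|n]; [|lra].
    apply is_derive_Reals. apply (is_derive_ext_loc f); [|apply is_derive_Reals, hf].
    exists (mkposreal (c - t) ltac:(lra)). intros y hy. change (Rabs (y - t) < c - t) in hy.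
    apply Rabs_def2 in hy. destruct (Rlt_dec y c); [reflexivity | lra].
  - destruct (Rlt_dec c c) as [n|_]; [lra|].
    intros eps heps. destruct (hf c eps heps) as [d1 h1]. destruct (hg c eps heps) as [d2 h2].
    pose proof (cond_pos d1). pose proof (cond_pos d2).
    exists (mkposreal (Rmin d1 d2) ltac:(apply Rmin_glb_lt; lra)). simpl.
    intros h hh hd. pose proof (Rmin_l d1 d2). pose proof (Rmin_r d1 d2).
    destruct (Rlt_dec c c) as [n|_]; [lra|].
    destruct (Rlt_dec (c + h) c).
    + rewrite <- e, <- de. apply h1; [exact hh | lra].
    + apply h2; [exact hh | lra].
  - destruct (Rlt_dec t c) as [n|_]; [lra|].
    apply is_derive_Reals. apply (is_derive_ext_loc g); [|apply is_derive_Reals, hg].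
    exists (mkposreal (t - c) ltac:(lra)). intros y hy. change (Rabs (y - t) < t - c) in hy.
    apply Rabs_def2 in hy. destruct (Rlt_dec y c); [lra | reflexivity].
Qed.

(** * Equilibria, and the criteria for leapfrogging below and above the threshold *)

Section Converse.
Variables (al s dl : R).
Hypothesis (hal : 0 < al) (hs : 1 < s) (hdl : 0 < dl).
Let A := al * s ^ 2.

Lemma A_pos : 0 < A.
Proof. apply Rmult_lt_0_compat; [exact hal | apply pow_lt; lra]. Qed.

Lemma G1_zero (x W : R) : Omega (s ^ 2) x W ->
  (G1 al (dl ^ 2) (s ^ 2) x W = 0 <-> W = 0).
Proof.
  intros hO. rewrite (G1_red al s dl hs hdl) by exact hO.
  apply (Omega_iff s dl hs hdl) in hO. destruct hO as [_ hr]. pose proof (rho_pos _ _ _ hr).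
  set (r := rho s x (s * W / dl)) in *. split.
  - intros E. assert (hc : s / dl ^ 2 * (al * s ^ 2) * (s / dl) / r ^ 3 <> 0).
    { assert (0 < s / dl ^ 2 * (al * s ^ 2) * (s / dl) / r ^ 3); [|lra].
      repeat first [ apply Rdiv_lt_0_compat | apply Rmult_lt_0_compat | apply pow_lt ]; lra. }
    apply (Rmult_eq_reg_l (s / dl ^ 2 * (al * s ^ 2) * (s / dl) / r ^ 3)); [|exact hc].
    rewrite Rmult_0_r, <- Ropp_0, <- E, Ropp_involutive. field. lra.
  - intros ->. field. lra.
Qed.

(** [G1] vanishes only for [W = 0], so [th] attains its extrema over a period on the axis. The time
    [tM] is kept nonnegative because the exclusion of equilibria in [leap_avoids_equilibrium] runs
    forward from time 0. *)
Lemma leapfrogging_turning_points (th W : R -> R) :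
  is_solution al (dl ^ 2) (s ^ 2) th W -> leapfrogging (s ^ 2) th W ->
  exists tm tM, 0 <= tM /\ th tm < th tM /\ W tm = 0 /\ W tM = 0.
Proof.
  intros hsol [hnc [[T [hT hper]] _]].
  assert (dth : forall t, is_derive th t (G1 al (dl ^ 2) (s ^ 2) (th t) (W t)))
    by (intros t; apply is_derive_Reals, hsol).
  assert (hp : forall t, th (t + T) = th t) by (intros t; apply hper).
  pose proof (derive_continuity th _ dth) as hc.
  destruct (continuity_ab_maj th 0 T) as [tM [hM hM']]; [lra | intros; apply hc|].
  destruct (continuity_ab_min th 0 T) as [tm [hm hm']]; [lra | intros; apply hc|].
  assert (gM : forall t, th t <= th tM).
  { intros t. destruct (periodic_window th T t hT hp) as [u [hu <-]]. apply hM, hu. }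
  assert (gm : forall t, th tm <= th t).
  { intros t. destruct (periodic_window th T t hT hp) as [u [hu <-]]. apply hm, hu. }
  assert (wM : W tM = 0).
  { apply (G1_zero (th tM)); [apply hsol|]. apply (derive_zero_at_max th tM); [apply dth | exact gM]. }
  assert (wm : W tm = 0).
  { apply (G1_zero (th tm)); [apply hsol|].
    rewrite <- (Ropp_involutive (G1 _ _ _ _ _)). apply Ropp_eq_0_compat.
    apply (derive_zero_at_max (fun t => - th t) tm).
    - apply (is_derive_opp th), dth.
    - intros x. pose proof (gm x). lra. }
  exists tm, tM. split; [lra|]. split; [|split; assumption].
  (* If the two extrema agreed, [th] would be constant, hence [W] would vanish and the solution
     would be constant. *)
  destruct (gM tm) as [l | E]; [exact l | exfalso].
  assert (hconst : forall t, th t = th tM).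
  { intros t. pose proof (gM t). pose proof (gm t). lra. }
  assert (hW0 : forall t, W t = 0).
  { intros t. apply (G1_zero (th t)); [apply hsol|].
    apply (derive_zero_at_max th t); [apply dth|]. intros x. rewrite (hconst t). apply gM. }
  destruct hnc as [t1 [t2 hn]]. apply hn. rewrite (hconst t1), (hconst t2), !hW0. reflexivity.
Qed.

Lemma solution_level (th W : R -> R) (t : R) : is_solution al (dl ^ 2) (s ^ 2) th W ->
  ham s A (th t) (s * W t / dl) = ham s A (th 0) (s * W 0 / dl).
Proof.
  intros hsol.
  apply (ham_const s A (s / dl ^ 2) th (fun t => s * W t / dl)), (is_solution_red al s dl); assumption.
Qed.

Lemma turning_point_level (th W : R -> R) (t : R) : is_solution al (dl ^ 2) (s ^ 2) th W ->
  W t = 0 -> 0 < th t /\ th t <> theta_g (s ^ 2) /\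
  ham s A (th t) 0 = ham s A (th 0) (s * W 0 / dl).
Proof.
  intros hsol hW. destruct (hsol t) as [[hx hn] _].
  split; [exact hx | split; [intros E; apply hn; split; assumption|]].
  rewrite <- (solution_level th W t hsol), hW. f_equal. unfold Rdiv; ring.
Qed.

(** Both turning points lie on the axis at the same level, and [ham] is strictly increasing there up
    to [theta_g]; so the larger one lies beyond [theta_g]. *)
Lemma leapfrogging_reaches_right (th W : R -> R) :
  is_solution al (dl ^ 2) (s ^ 2) th W -> leapfrogging (s ^ 2) th W ->
  exists t, 0 <= t /\ theta_g (s ^ 2) < th t /\ W t = 0 /\
    ham s A (th t) 0 = ham s A (th 0) (s * W 0 / dl).
Proof.
  intros hsol hl. destruct (leapfrogging_turning_points th W hsol hl) as [tm [tM [h0 [hlt [wm wM]]]]].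
  destruct (turning_point_level th W tm hsol wm) as [m0 [m1 m2]].
  destruct (turning_point_level th W tM hsol wM) as [M0 [M1 M2]].
  exists tM. split; [exact h0|]. split; [|split; assumption].
  destruct (Rtotal_order (theta_g (s ^ 2)) (th tM)) as [l | [l | l]]; [exact l | congruence | exfalso].
  pose proof (axis_incr_left s A hs A_pos _ _ m0 hlt l). lra.
Qed.

(* Stopping forever on arrival at an equilibrium gives another solution with the same
   initial data, and that one is not periodic unless it is constant: this replaces uniqueness
   for the Cauchy problem. *)
Lemma leap_avoids_equilibrium (th W : R -> R) (c : R) :
  is_solution al (dl ^ 2) (s ^ 2) th W -> leap_from al (dl ^ 2) (s ^ 2) (th 0) (W 0) ->
  0 <= c -> ~ equilibrium al (dl ^ 2) (s ^ 2) (th c) (W c).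
Proof.
  intros hsol [_ hl] hc [hO [e1 e2]].
  set (th' := fun t => if Rlt_dec t c then th t else th c).
  set (W' := fun t => if Rlt_dec t c then W t else W c).
  assert (after : forall t, c <= t -> th' t = th c /\ W' t = W c).
  { intros t ht. unfold th', W'. destruct (Rlt_dec t c); [lra | split; reflexivity]. }
  assert (before : forall t, t <= c -> th' t = th t /\ W' t = W t).
  { intros t [ht | ->]; [|apply after; lra].
    unfold th', W'. destruct (Rlt_dec t c); [split; reflexivity | lra]. }
  assert (hsol' : is_solution al (dl ^ 2) (s ^ 2) th' W').
  { intros t.
    pose proof (glue_derivable th (fun _ => th c) c _ (fun _ => 0)
      (fun t => proj1 (proj2 (hsol t))) (derivable_pt_lim_const (th c)) eq_refl e1 t) as d1.
    pose proof (glue_derivable W (fun _ => W c) c _ (fun _ => 0)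
      (fun t => proj2 (proj2 (hsol t))) (derivable_pt_lim_const (W c)) eq_refl e2 t) as d2.
    fold th' in d1. fold W' in d2.
    destruct (Rlt_dec t c) as [l | l].
    - rewrite (proj1 (before t ltac:(lra))), (proj2 (before t ltac:(lra))).
      split; [apply hsol | split; assumption].
    - rewrite (proj1 (after t ltac:(lra))), (proj2 (after t ltac:(lra))), e1, e2.
      split; [exact hO | split; assumption]. }
  destruct (hl th' W' hsol' (proj1 (before 0 hc)) (proj2 (before 0 hc))) as [[t1 [t2 hn]] [[T [hT hper]] _]].
  assert (hconst : forall t, th' t = th c /\ W' t = W c).
  { intros t. destruct (periodic_shift_ge T t c hT) as [n hn'].
    rewrite <- (periodic_nat th' T (fun t => proj1 (hper t)) n t).
    rewrite <- (periodic_nat W' T (fun t => proj2 (hper t)) n t).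
    apply after, hn'. }
  apply hn. rewrite (proj1 (hconst t1)), (proj2 (hconst t1)), (proj1 (hconst t2)), (proj2 (hconst t2)).
  reflexivity.
Qed.

(** The vertical line through [theta_g] misses such an orbit; it is connected and unbounded, so the
    component of [(theta_g, 0)] is unbounded. *)
Lemma not_leapfrogging_right (B : R) (th W : R -> R) : theta_g (s ^ 2) < B ->
  (forall t, B < th t) -> ~ leapfrogging (s ^ 2) th W.
Proof.
  intros hB hth [_ [_ [_ [M hM]]]].
  set (p := (theta_g (s ^ 2), 0)) in *.
  specialize (hM (fun q => fst q = theta_g (s ^ 2)) (vertical_line_connected _) eq_refl).
  assert (hK : forall q : R * R, fst q = theta_g (s ^ 2) -> ~ (exists t, q = (th t, W t))).
  { intros q hq [t ->]. change (th t = theta_g (s ^ 2)) in hq. specialize (hth t). lra. }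
  specialize (hM hK (theta_g (s ^ 2), Rabs M + 1) eq_refl).
  assert (h : Rabs (Rabs M + 1 - 0) <= dist2 p (theta_g (s ^ 2), Rabs M + 1))
    by exact (proj2 (dist2_coords p (theta_g (s ^ 2), Rabs M + 1))).
  pose proof (Rle_abs M). pose proof (Rle_abs (Rabs M + 1 - 0)). lra.
Qed.

(** [G1] confines equilibria to the axis. There the two terms of [G2] are both negative to the left
    of [theta_g]; to the right they cancel exactly when [qfun s (tanh x) = A]. *)
Lemma equilibrium_iff (x W : R) : equilibrium al (dl ^ 2) (s ^ 2) x W <->
  W = 0 /\ theta_g (s ^ 2) < x /\ qfun s (tanh x) = A.
Proof.
  pose proof A_pos as hA. pose proof (theta_g_pos s hs) as hg.
  assert (hk : 0 < s / dl ^ 2) by (apply Rdiv_lt_0_compat; [lra | apply pow_lt; lra]).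
  assert (hy : s * 0 / dl = 0) by (unfold Rdiv; ring).
  split.
  - intros [hO [e1 e2]]. apply G1_zero in e1; [|exact hO]. subst W. split; [reflexivity|].
    pose proof (G2_red al s dl hs hdl _ _ hO) as E. rewrite e2, Rmult_0_r, hy in E. fold A in E.
    destruct hO as [hx hn].
    destruct (Rtotal_order x (theta_g (s ^ 2))) as [l | [l | l]].
    + exfalso. apply (cc_pos_iff s hs) in l. rewrite rho_axis_pos in E by exact l.
      pose proof (dFpot_pos s x hs hx). pose proof (dcc_neg s x hs).
      assert (0 < A * - dcc s x * cc s x / cc s x ^ 3).
      { apply Rdiv_lt_0_compat; [|apply pow_lt; exact l].
        repeat apply Rmult_lt_0_compat; lra. }
      assert (A * dcc s x * cc s x / cc s x ^ 3 = - (A * - dcc s x * cc s x / cc s x ^ 3)) by (field; lra).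
      nra.
    + exfalso. apply hn. split; [exact l | reflexivity].
    + split; [exact l|]. apply (cc_neg_iff s hs) in l. rewrite rho_axis_neg in E by exact l.
      pose proof (axis_derive_sign s A hs x hx l) as D.
      pose proof (dcc_ratio_pos s hs x l).
      assert (hD : dFpot s x - A * - dcc s x / cc s x ^ 2 = 0).
      { apply (Rmult_eq_reg_l (s / dl ^ 2)); [|lra]. rewrite Rmult_0_r, <- Ropp_0, E. field. lra. }
      rewrite hD in D. nra.
  - intros [-> [l hq]].
    assert (hO : Omega (s ^ 2) x 0) by (split; [lra | intros [E _]; lra]).
    split; [exact hO|]. split; [apply G1_zero; [exact hO | reflexivity]|].
    pose proof (G2_red al s dl hs hdl _ _ hO) as E. rewrite hy in E. fold A in E.
    apply (cc_neg_iff s hs) in l. rewrite rho_axis_neg in E by exact l.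
    pose proof (axis_derive_sign s A hs x (proj1 hO) l) as D. rewrite hq in D.
    assert (0 < s / dl) by (apply Rdiv_lt_0_compat; lra).
    apply (Rmult_eq_reg_l (s / dl)); [|lra]. rewrite E, Rmult_0_r.
    transitivity (- (s / dl ^ 2) * (dFpot s x - A * - dcc s x / cc s x ^ 2)); [field; lra|].
    rewrite D. ring.
Qed.

Lemma Gc_axis (x : R) : 0 < x -> x <> theta_g (s ^ 2) ->
  Gc al (dl ^ 2) (s ^ 2) x 0 = / dl * ham s A x 0.
Proof.
  intros hx hn. rewrite (Gc_ham al s dl hs hdl).
  - f_equal. f_equal. unfold Rdiv; ring.
  - split; [exact hx | tauto].
Qed.

Lemma leap_iff_subcritical (x W : R) : qfun s 1 <= A -> Omega (s ^ 2) x W ->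
  (leap_from al (dl ^ 2) (s ^ 2) x W <-> ham s A x (s * W / dl) > s ^ 3 * PI / 2).
Proof.
  intros hq hO. pose proof A_pos as hA. pose proof (theta_g_pos s hs) as hg. split.
  - intros hl. destruct (proj1 hl) as [th [w [hsol [i1 i2]]]].
    destruct (leapfrogging_reaches_right th w hsol (proj2 hl th w hsol i1 i2)) as [t [_ [ht [_ E]]]].
    rewrite <- i1, <- i2, <- E. apply axis_gt_limit; assumption.
  - intros hh. set (h := ham s A x (s * W / dl)) in *.
    (* Far enough out [A / - cc s B] is less than [e], the excess of the level over the limit of
       [Fpot]; [B] is also taken beyond [x], so the initial point lies in the window. *)
    pose (e := h - s ^ 3 * PI / 2).
    destruct (cc_unbounded s hs (- (A / e)) (Rmax (theta_g (s ^ 2)) x)) as [B [hB hB']].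
    pose proof (Rmax_l (theta_g (s ^ 2)) x). pose proof (Rmax_r (theta_g (s ^ 2)) x).
    apply (leap_of_window al s dl hs hdl B h); [|exact hO | lra | reflexivity].
    apply window_of_axis; [exact hs | exact hA | lra | |].
    + pose proof (qfun_tanh_lt_1 s hs B ltac:(lra)). fold A. lra.
    + assert (he : 0 < e) by (unfold e; lra).
      assert (0 < A / e) by (apply Rdiv_lt_0_compat; lra).
      unfold ham. rewrite rho_axis_neg by lra.
      pose proof (Fpot_lt_limit s hs B ltac:(lra)).
      assert (A / - cc s B < e).
      { apply (Rmult_lt_reg_r (- cc s B)); [lra|]. unfold Rdiv. rewrite Rmult_assoc, Rinv_l by lra.
        replace (A * 1) with (e * (A / e)) by (field; lra). apply Rmult_lt_compat_l; lra. }
      fold A. unfold e in *. lra.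
Qed.

(** On the axis to the right of [theta_g], [ham] has its strict minimum at [ths]. A leapfrogging
    orbit reaches that half-axis but not at the equilibrium, so its level exceeds the minimum.
    Conversely [B = ths] gives a window. *)
Lemma leap_iff_supercritical (ths thb x W : R) : theta_g (s ^ 2) < ths -> qfun s (tanh ths) = A ->
  0 < thb < theta_g (s ^ 2) -> ham s A thb 0 = ham s A ths 0 -> Omega (s ^ 2) x W ->
  (leap_from al (dl ^ 2) (s ^ 2) x W <->
   (thb < x < ths /\ ham s A x (s * W / dl) > ham s A ths 0)).
Proof.
  intros hths hq hthb hm hO. pose proof A_pos as hA. pose proof (theta_g_pos s hs) as hg.
  assert (hmin : forall z, theta_g (s ^ 2) < z -> z <> ths -> ham s A ths 0 < ham s A z 0).
  { intros z hz hn. destruct (Rtotal_order z ths) as [l | [l | l]]; [|contradiction|].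
    - apply axis_decr_right; try assumption. lra.
    - apply axis_incr_right; try assumption. lra. }
  assert (hcs : cc s ths < 0) by (apply (cc_neg_iff s hs); exact hths).
  split.
  - intros hl. destruct (proj1 hl) as [th [w [hsol [i1 i2]]]].
    pose proof (proj2 hl th w hsol i1 i2) as hlf.
    destruct (leapfrogging_reaches_right th w hsol hlf) as [t [h0 [ht [wt E]]]].
    rewrite i1, i2 in E.
    assert (hgt : ham s A x (s * W / dl) > ham s A ths 0).
    { rewrite <- E. apply hmin; [exact ht|]. intros e.
      rewrite <- i1, <- i2 in hl. apply (leap_avoids_equilibrium th w t hsol hl h0).
      apply equilibrium_iff. rewrite e. auto. }
    split; [|exact hgt]. split.
    + destruct (Rlt_le_dec thb x) as [|l]; [assumption|]. exfalso.
      (* At or to the left of [thb] the Hamiltonian is at most its axis value at [thb], which equals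
         the one at [ths]. *)
      assert (hc : 0 < cc s x) by (apply (cc_pos_iff s hs); lra).
      pose proof (ham_le_axis s A hA x (s * W / dl) ltac:(lra)).
      destruct l as [l | ->]; [|lra].
      pose proof (axis_incr_left s A hs hA x thb (proj1 hO) l ltac:(lra)). lra.
    + destruct (Rlt_le_dec x ths) as [|l]; [assumption|]. exfalso.
      (* On the line [th = ths] the Hamiltonian is at most its axis value, hence below the level of
         the orbit. An orbit starting to the right of that line therefore stays there and cannot go
         around [theta_g]. *)
      assert (hne : forall u, th u <> ths).
      { intros u e. pose proof (solution_level th w u hsol) as Eu.
        rewrite e, i1, i2 in Eu.
        pose proof (ham_le_axis s A hA ths (s * w u / dl) ltac:(lra)). lra. }
      apply (not_leapfrogging_right ths th w hths); [|exact hlf].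
      intros u.
      assert (hcont : continuity (fun t => - th t)).
      { apply (derive_continuity _ (fun t => - G1 al (dl ^ 2) (s ^ 2) (th t) (w t))).
        intros v. apply (is_derive_opp th), is_derive_Reals, hsol. }
      pose proof (no_crossing (fun t => - th t) (- ths) hcont) as hnc. simpl in hnc.
      assert (- th u < - ths); [|lra].
      apply hnc; [intros v e; apply (hne v); lra | pose proof (hne 0); lra].
  - intros [hx hh].
    apply (leap_of_window al s dl hs hdl ths (ham s A x (s * W / dl)));
      [|exact hO | lra | reflexivity].
    apply window_of_axis; try assumption. fold A. lra.
Qed.
End Converse.

(** * The threshold *)

Lemma threshold_ratio_incr (s t : R) : 1 <= s -> s < t ->
  (s ^ 3 + 1) * (s - 1) * t ^ 2 < (t ^ 3 + 1) * (t - 1) * s ^ 2.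
Proof.
  intros hs hst.
  assert (h1 : 1 <= s * t) by nra.
  (* This product is the difference of the two sides; so [qfun s 1 / s ^ 2] increases, and its
     comparison with [al] changes only once. *)
  assert (h2 : 0 < (t - s) * ((s * t) * (s * t) * (t + s - 1) - s * t + t + s)).
  { apply Rmult_lt_0_compat; [lra|].
    assert (s * t * 1 <= s * t * (s * t)) by (apply Rmult_le_compat_l; lra).
    assert (s * t * (s * t) * 1 <= s * t * (s * t) * (t + s - 1)) by (apply Rmult_le_compat_l; nra).
    lra. }
  lra.
Qed.

Theorem theorem4 (al : R) (hal0 : 0 < al) (hal1 : al < / 3) :
  exists gs : R, 1 < gs /\
  forall d : R, 0 < d ->
  (forall g : R, 1 < g -> g <= gs ->
     (forall th W, ~ equilibrium al d g th W) /\
     (forall th0 W0, Omega g th0 W0 ->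
        (leap_from al d g th0 W0 <->
         Gc al d g th0 W0 > PI * pow32 g / (2 * sqrt d)))) /\
  (forall g : R, gs < g ->
     exists ths : R, theta_g g < ths /\
     (forall th W, equilibrium al d g th W <-> (th = ths /\ W = 0)) /\
     exists thb : R,
       (0 < thb < theta_g g /\ Gc al d g thb 0 = Gc al d g ths 0) /\
       (forall th', 0 < th' < theta_g g -> Gc al d g th' 0 = Gc al d g ths 0 ->
          th' = thb) /\
       (forall th0 W0, Omega g th0 W0 ->
          (leap_from al d g th0 W0 <->
           (thb < th0 < ths /\ Gc al d g th0 W0 > Gc al d g ths 0)))).
Proof.
  (* The threshold is [ss ^ 2], where [ss] solves [qfun s 1 = al * s ^ 2]; the difference of the two
     sides is [- al] at 1 and [9 - 4 * al] at 2. *)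
  destruct (IVT_interv (fun s => (s ^ 3 + 1) * (s - 1) - al * s ^ 2) 1 2) as [ss [hss hss']]; try lra.
  { intros s _. assert (ex_derive (fun s => (s ^ 3 + 1) * (s - 1) - al * s ^ 2) s) as [l hl]
      by (auto_derive; auto).
    exact (continuity_pt_derive _ _ _ hl). }
  assert (ss <> 1) by (intros ->; lra).
  exists (ss ^ 2). split; [nra|]. intros d0 hd0.
  (* Here [d], and later [g], is written as a square, the form in which the rescaling is stated. *)
  rewrite <- (pow2_sqrt d0) by lra. pose proof (sqrt_lt_R0 d0 hd0) as hdl.
  set (dl := sqrt d0) in *. clearbody dl. clear d0 hd0.
  assert (hinv : 0 < / dl) by (apply Rinv_0_lt_compat; exact hdl).
  split; intros g0.
  - intros hg0 hgs.
    assert (hs : 1 < sqrt g0) by (rewrite <- sqrt_1; apply sqrt_lt_1_alt; lra).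
    assert (hle : sqrt g0 <= ss).
    { rewrite <- (sqrt_pow2 ss) by lra. apply sqrt_le_1_alt; lra. }
    rewrite <- (pow2_sqrt g0) by lra. set (s := sqrt g0) in *. clearbody s. clear g0 hg0 hgs.
    assert (hq : qfun s 1 <= al * s ^ 2).
    { rewrite qfun_1 by exact hs. destruct hle as [l | ->]; [|lra].
      pose proof (threshold_ratio_incr s ss ltac:(lra) l) as h.
      assert (0 < ss ^ 2) by (apply pow_lt; lra). nra. }
    split.
    + intros th W he. apply equilibrium_iff in he; try assumption. destruct he as [_ [h1 h2]].
      pose proof (qfun_tanh_lt_1 s hs th h1). lra.
    + intros th0 W0 hO. rewrite (leap_iff_subcritical al s dl hal0 hs hdl) by assumption.
      rewrite (Gc_ham al s dl hs hdl) by exact hO.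
      unfold pow32. rewrite !sqrt_pow2 by lra.
      replace (PI * (s ^ 2 * s) / (2 * dl)) with (/ dl * (s ^ 3 * PI / 2)) by (field; lra).
      split; intros h.
      * apply Rmult_lt_compat_l; assumption.
      * apply (Rmult_lt_reg_l (/ dl)); assumption.
  - intros hgs.
    assert (hs : ss < sqrt g0).
    { rewrite <- (sqrt_pow2 ss) by lra. apply sqrt_lt_1_alt. nra. }
    assert (hg0 : 0 <= g0) by nra.
    rewrite <- (pow2_sqrt g0) by exact hg0. set (s := sqrt g0) in *. clearbody s. clear g0 hg0 hgs.
    assert (hs1 : 1 < s) by lra.
    assert (hA : 0 < al * s ^ 2) by (apply Rmult_lt_0_compat; [lra | apply pow_lt; lra]).
    assert (hq : al * s ^ 2 < qfun s 1).
    { rewrite qfun_1 by exact hs1.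
      pose proof (threshold_ratio_incr ss s ltac:(lra) hs) as h.
      assert (0 < ss ^ 2) by (apply pow_lt; lra). nra. }
    destruct (qfun_root s (al * s ^ 2) hs1 hA hq) as [ths [h1 h2]].
    destruct (axis_onto_left s (al * s ^ 2) hs1 hA (ham s (al * s ^ 2) ths 0)) as [thb [h3 h4]].
    pose proof (theta_g_pos s hs1) as hg.
    assert (hGs : Gc al (dl ^ 2) (s ^ 2) ths 0 = / dl * ham s (al * s ^ 2) ths 0)
      by (apply Gc_axis; try assumption; lra).
    exists ths. split; [exact h1|]. split; [|exists thb; split; [|split]].
    + intros th W. rewrite equilibrium_iff by assumption. split.
      * intros [e1 [e2 e3]]. split; [|exact e1].
        apply (qfun_tanh_inj s hs1); try assumption. lra.
      * intros [-> ->]. auto.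
    + split; [exact h3|]. rewrite hGs, Gc_axis, h4; try assumption; lra.
    + intros th' hth' E. rewrite hGs, Gc_axis in E; try assumption; try lra.
      apply Rmult_eq_reg_l in E; [|lra]. rewrite <- h4 in E.
      destruct (Rtotal_order th' thb) as [l | [l | l]]; [|exact l|].
      * pose proof (axis_incr_left s _ hs1 hA th' thb ltac:(lra) l ltac:(lra)). lra.
      * pose proof (axis_incr_left s _ hs1 hA thb th' ltac:(lra) l ltac:(lra)). lra.
    + intros th0 W0 hO.
      rewrite (leap_iff_supercritical al s dl hal0 hs1 hdl ths thb) by assumption.
      rewrite hGs, (Gc_ham al s dl hs1 hdl) by exact hO.
      split; intros [a b]; (split; [exact a|]).
      * apply Rmult_lt_compat_l; assumption.
      * apply (Rmult_lt_reg_l (/ dl)); assumption.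
Qed.
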